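(* Let $G$ be a compact Lie group and $H$ a closed subgroup, with Lie algebras $\mathfrak g$ and $\mathfrak h$ respectively. Let $m\neq 0,-1$ and let $(G/H,F)$ be a homogeneous Finsler space of Berwald type, where $F=\dfrac{\alpha^{m+1}}{\beta^{m}}$ is the generalized $m$-Kropina metric defined by an invariant Riemannian metric $\langle\cdot,\cdot\rangle$ on $G/H$ and an invariant vector field $\tilde X$ on $G/H$ with $\tilde X(H)=X$. Then $(G/H,F)$ is naturally reductive (in the sense of Latifi) if and only if the Riemannian space $(G/H,\langle\cdot,\cdot\rangle)$ is naturally reductive.
   Context: ''Invariant'' means $G$-invariant; $H$ also denotes the base point $eH$ of $G/H$. $\langle\cdot,\cdot\rangle$ also denotes the inner product induced on $\mathfrak m\cong T_H(G/H)$, where $\mathfrak g=\mathfrak h+\mathfrak m$ is an $\mathrm{Ad}(H)$-invariant decomposition ($\mathrm{Ad}(h)\mathfrak m\subset\mathfrak m$ for all $h\in H$), and $[\cdot,\cdot]_{\mathfrak m}$ is the $\mathfrak m$-component of the bracket. Metric. $\alpha$ is the norm of $\langle\cdot,\cdot\rangle$ and $\beta(y)=\langle\tilde X,y\rangle$, so at the base point $F(Y)=\langle Y,Y\rangle^{(m+1)/2}/\langle X,Y\rangle^{m}$; $F$ is considered only at vectors with $\beta>0$, and conditions ''for all $y\ne0$'' involving $F$ are required for all $y$ in this domain. A Finsler metric is smooth and positively homogeneous of degree 1 in $y$, with positive definite fundamental tensor $g_y(u,v)=\frac12\frac{\partial^2}{\partial s\,\partial t}F^2(y+su+tv)\big|_{s=t=0}$.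 The Cartan tensor is $C_y(z,u,v)=\frac12\frac{d}{dt}\big[g_{y+tv}(z,u)\big]\big|_{t=0}$. $F$ is of Berwald type if its Chern connection is a linear connection on the tangent bundle, i.e. the Chern connection coefficients $\Gamma^i_{jk}$ in standard coordinates do not depend on $y$. Naturally reductive Riemannian space: $(G/H,\langle\cdot,\cdot\rangle)$ is naturally reductive if there is an $\mathrm{Ad}(H)$-invariant decomposition $\mathfrak g=\mathfrak h+\mathfrak m$ such that $\langle[Z,U]_{\mathfrak m},V\rangle+\langle U,[Z,V]_{\mathfrak m}\rangle=0$ for all $Z,U,V\in\mathfrak m$. Naturally reductive Finsler space (Latifi): $(G/H,F)$ is naturally reductive if there is an $\mathrm{Ad}(H)$-invariant decomposition $\mathfrak g=\mathfrak h+\mathfrak m$ such that $$g_y([z,u]_{\mathfrak m},v)+g_y([z,v]_{\mathfrak m},u)+2C_y([z,y]_{\mathfrak m},u,v)=0$$ for all $y\neq0$ and $z,u,v\in\mathfrak m$. *)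

(* Defs.v *)
From HB Require Import structures.
From mathcomp Require Import all_boot all_order all_algebra.
From mathcomp Require Import all_classical all_reals all_analysis.

Set Implicit Arguments.
Unset Strict Implicit.
Unset Printing Implicit Defensive.

Import Order.TTheory GRing.Theory Num.Theory.
Import numFieldNormedType.Exports.

Local Open Scope classical_set_scope.
Local Open Scope ring_scope.
Local Open Scope quotient_scope.

Section SmoothOn.
Context {R : realType} {V W : normedModType R}.

Fixpoint Ck_on (k : nat) (U : set V) (f : V -> W) : Prop :=
  match k with
  | 0 => forall x, U x -> {for x, continuous f}
  | k'.+1 => (forall x, U x -> differentiable f x) /\
             (forall v : V, Ck_on k' U ('D_v f))
  end.

(* Meant for open [U] and finite-dimensional [V]; there this is the usual C^oo,
   since continuity of all directional derivatives is continuity of ['d f]. *)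
Definition smooth_on (U : set V) (f : V -> W) : Prop :=
  forall k, Ck_on k U f.

End SmoothOn.

(* [cmap] and [cinv] are total functions; their values outside [cdom] and
   outside [cimg] respectively are irrelevant. *)
Record chart (R : realType) (T : topologicalType) (n : nat) := Chart {
  cdom : set T;
  cmap : T -> 'rV[R]_n;
  cinv : 'rV[R]_n -> T;
  cdom_open : open cdom;
  cimg_open : open (cmap @` cdom);
  cmapK : forall p, cdom p -> cinv (cmap p) = p;
  cmap_continuous : forall p, cdom p -> {for p, continuous cmap};
  cinv_continuous : forall x, (cmap @` cdom) x -> {for x, continuous cinv}
}.

Definition cimg R T n (c : @chart R T n) : set 'rV[R]_n := cmap c @` cdom c.

(* [chart_at p] is a preferred chart around [p].  The tangent space at [p] is
   represented by ['rV[R]_n]: a row vector stands for the tangent vector whose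
   components in [chart_at p] are its entries. *)
Record smooth_structure (R : realType) (T : topologicalType) (n : nat) :=
  SmoothStructure {
    atlas : set (chart R T n);
    chart_at : T -> chart R T n;
    chart_at_atlas : forall p, atlas (chart_at p);
    chart_at_dom : forall p, cdom (chart_at p) p;
    atlas_compat : forall c c', atlas c -> atlas c' ->
      smooth_on (cmap c @` (cdom c `&` cdom c')) (cmap c' \o cinv c);
    manifold_hausdorff : hausdorff_space T;
    manifold_second_countable : @second_countable T
  }.

Section Manifold.
Context {R : realType} {T : topologicalType} {n : nat}.
Variable S : smooth_structure R T n.

(* The tangent vector at [cinv c x] with components [v] in the chart [c]. *)
Definition from_chart (c : chart R T n) (x v : 'rV[R]_n) : 'rV[R]_n :=
  'd (cmap (chart_at S (cinv c x)) \o cinv c) x v.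

(* The components in the chart [c] of the tangent vector [v] at [p]. *)
Definition to_chart (c : chart R T n) (p : T) (v : 'rV[R]_n) : 'rV[R]_n :=
  'd (cmap c \o cinv (chart_at S p)) (cmap (chart_at S p) p) v.

Definition field_in (c : chart R T n) (X : T -> 'rV[R]_n) :
    'rV[R]_n -> 'rV[R]_n :=
  fun x => to_chart c (cinv c x) (X (cinv c x)).

Definition smooth_field (X : T -> 'rV[R]_n) : Prop :=
  forall c, atlas S c -> smooth_on (cimg c) (field_in c X).

(* The value at [p] of [X, Y]: in coordinates
   [X, Y]^i = X^j d_j Y^i - Y^j d_j X^i. *)
Definition field_bracket (X Y : T -> 'rV[R]_n) (p : T) : 'rV[R]_n :=
  let c := chart_at S p in
  'D_(X p) (field_in c Y) (cmap c p) - 'D_(Y p) (field_in c X) (cmap c p).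

End Manifold.

Section Maps.
Context {R : realType} {T1 T2 T3 : topologicalType} {n1 n2 n3 : nat}.
Variables (S1 : smooth_structure R T1 n1) (S2 : smooth_structure R T2 n2).
Variable S3 : smooth_structure R T3 n3.

Definition smooth_map (f : T1 -> T2) : Prop :=
  continuous f /\
  forall c1 c2, atlas S1 c1 -> atlas S2 c2 ->
    smooth_on (cmap c1 @` [set p | cdom c1 p /\ cdom c2 (f p)])
      (cmap c2 \o f \o cinv c1).

Definition smooth_map2 (f : T1 -> T2 -> T3) : Prop :=
  continuous (fun p : T1 * T2 => f p.1 p.2) /\
  forall c1 c2 c3, atlas S1 c1 -> atlas S2 c2 -> atlas S3 c3 ->
    smooth_on
      [set row_mx (cmap c1 p.1) (cmap c2 p.2) | p in
         [set p : T1 * T2 | [/\ cdom c1 p.1, cdom c2 p.2 &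
                               cdom c3 (f p.1 p.2)]]]
      (fun w : 'rV[R]_(n1 + n2) =>
         cmap c3 (f (cinv c1 (lsubmx w)) (cinv c2 (rsubmx w)))).

Definition mdiff (f : T1 -> T2) (p : T1) (v : 'rV[R]_n1) : 'rV[R]_n2 :=
  'd (cmap (chart_at S2 (f p)) \o f \o cinv (chart_at S1 p))
     (cmap (chart_at S1 p) p) v.

Definition submersion (f : T1 -> T2) : Prop :=
  smooth_map f /\ forall p w, exists v, mdiff f p v = w.

End Maps.

#[short(type="topGroupType")]
HB.structure Definition TopGroup := {G of Group G & Topological G}.

Definition lie_group (R : realType) (G : topGroupType) (d : nat)
    (S : smooth_structure R G d) : Prop :=
  smooth_map2 S S S (fun x y : G => (x * y)%g) /\
  smooth_map S S (fun x : G => (x^-1)%g).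

Record closed_subgroup (G : topGroupType) := ClosedSubgroup {
  subgroup_set :> set G;
  subgroup1 : subgroup_set 1%g;
  subgroupM : forall x y, subgroup_set x -> subgroup_set y ->
    subgroup_set (x * y)%g;
  subgroupV : forall x, subgroup_set x -> subgroup_set (x^-1)%g;
  subgroup_closed : closed subgroup_set
}.

Section CosetSpace.
Variables (G : topGroupType) (H : closed_subgroup G).

Definition coset_rel (x y : G) : bool := `[< subgroup_set H (x^-1 * y)%g >].

Lemma coset_rel_refl : reflexive coset_rel.
Proof. by move=> x; apply/asboolP; rewrite mulVg; exact: subgroup1. Qed.

Lemma coset_rel_sym : symmetric coset_rel.
Proof.
move=> x y; apply/asboolP/asboolP => /subgroupV; by rewrite invgM invgK.
Qed.

Lemma coset_rel_trans : transitive coset_rel.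
Proof.
move=> y x z /asboolP xy /asboolP yz; apply/asboolP.
by have := subgroupM xy yz; rewrite -mulgA mulVKg.
Qed.

Canonical coset_equiv := EquivRel coset_rel
  coset_rel_refl coset_rel_sym coset_rel_trans.

Definition coset_space := quotient_topology {eq_quot coset_equiv}.

(* For a Lie group G, [coset_space] has exactly one smooth structure making
   [coset_proj] a submersion: the standard one on G/H. *)
Definition coset_proj (g : G) : coset_space := \pi_coset_space g.

Definition base_point : coset_space := coset_proj 1%g.

Definition coset_act (g : G) (p : coset_space) : coset_space :=
  coset_proj (g * repr p)%g.

End CosetSpace.

Section LieAlgebra.
Context {R : realType} {G : topGroupType} {d : nat}.
Variable S : smooth_structure R G d.

(* The Lie algebra of G is the tangent space ['rV[R]_d] at 1, with the bracket
   of left-invariant vector fields. *)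
Definition left_field (v : 'rV[R]_d) (g : G) : 'rV[R]_d :=
  mdiff S S (fun x : G => (g * x)%g) 1%g v.

Definition lie_bracket (u v : 'rV[R]_d) : 'rV[R]_d :=
  field_bracket S (left_field u) (left_field v) 1%g.

Definition Ad (g : G) : 'rV[R]_d -> 'rV[R]_d :=
  mdiff S S (fun x : G => (g * x * g^-1)%g) 1%g.

Definition one_parameter_subgroup (gam : R -> G) (v : 'rV[R]_d) : Prop :=
  [/\ continuous gam,
      forall s t, gam (s + t) = (gam s * gam t)%g &
      is_derive (0 : R) (1 : R) (cmap (chart_at S 1%g) \o gam) v].

(* The tangent vectors v such that exp(t v) is in H for all t. *)
Definition lie_subalgebra (H : set G) : set 'rV[R]_d :=
  [set v | exists2 gam, one_parameter_subgroup gam v & forall t, H (gam t)].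

Definition reductive_decomposition (H : set G) (h q : {vspace 'rV[R]_d}) :
    Prop :=
  [/\ forall v, v \in h <-> lie_subalgebra H v,
      (h + q = fullv)%VS,
      directv (h + q) &
      forall x v, H x -> v \in q -> Ad x v \in q].

(* [z, u]_q; [daddv_pi q h] is the projection onto q along h. *)
Definition bracket_proj (h q : {vspace 'rV[R]_d}) (z u : 'rV[R]_d) :
    'rV[R]_d :=
  daddv_pi q h (lie_bracket z u).

End LieAlgebra.

Definition inner (R : realType) (n : nat) (A : 'M[R]_n) (u v : 'rV[R]_n) : R :=
  (u *m A *m v^T) 0 0.

(* [a p] is the Gram matrix of the metric on the tangent space at [p]. *)
Definition riemannian_metric (R : realType) (T : topologicalType) (n : nat)
    (S : smooth_structure R T n) (a : T -> 'M[R]_n) : Prop :=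
  [/\ forall p, (a p)^T = a p,
      forall p v, v != 0 -> 0 < inner (a p) v v &
      forall c (i j : 'I_n), atlas S c -> smooth_on (cimg c)
        (fun x => inner (a (cinv c x))
           (from_chart S c x (delta_mx 0 i))
           (from_chart S c x (delta_mx 0 j)) : R)].

Section FundamentalTensor.
Context {R : realType} {V : normedModType R}.

Definition fundamental_tensor (F : V -> R) (y u v : V) : R :=
  2^-1 * 'D_u ('D_v (fun w => F w ^+ 2 : R)) y.

Definition cartan_tensor (F : V -> R) (y z u v : V) : R :=
  2^-1 * 'D_v (fun w => fundamental_tensor F w z u : R) y.

End FundamentalTensor.

(* The Chern connection coefficients in coordinates (Bao-Chern-Shen); [F x y] is the metric at
   the point x and the vector y.
     gamma^i_jk = 1/2 g^is (d_k g_sj - d_s g_jk + d_j g_ks)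
     N^i_j      = gamma^i_jk y^k - C^i_jk gamma^k_rs y^r y^s
     delta_k    = d/dx^k - N^i_k d/dy^i
     Gamma^i_jk = 1/2 g^is (delta_k g_sj - delta_s g_jk + delta_j g_ks). *)
Section ChernConnection.
Context {R : realType} {n : nat}.
Variable F : 'rV[R]_n -> 'rV[R]_n -> R.

Let e (i : 'I_n) : 'rV[R]_n := delta_mx 0 i.

Definition gmx (x y : 'rV[R]_n) : 'M[R]_n :=
  \matrix_(i, j) fundamental_tensor (F x) y (e i) (e j).

Definition ginv (x y : 'rV[R]_n) : 'M[R]_n := invmx (gmx x y).

Definition dx_g (k i j : 'I_n) (x y : 'rV[R]_n) : R :=
  'D_(e k) (fun z => gmx z y i j : R) x.

Definition dy_g (k i j : 'I_n) (x y : 'rV[R]_n) : R :=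
  'D_(e k) (fun z => gmx x z i j : R) y.

Definition formal_christoffel (i j k : 'I_n) (x y : 'rV[R]_n) : R :=
  2^-1 * \sum_s ginv x y i s *
    (dx_g k s j x y - dx_g s j k x y + dx_g j k s x y).

Definition cartan_up (i j k : 'I_n) (x y : 'rV[R]_n) : R :=
  \sum_s ginv x y i s * cartan_tensor (F x) y (e s) (e j) (e k).

Definition nonlinear_connection (i j : 'I_n) (x y : 'rV[R]_n) : R :=
  \sum_k formal_christoffel i j k x y * y 0 k -
  \sum_k \sum_r \sum_s cartan_up i j k x y *
    formal_christoffel k r s x y * y 0 r * y 0 s.

Definition delta_g (k i j : 'I_n) (x y : 'rV[R]_n) : R :=
  dx_g k i j x y - \sum_l nonlinear_connection l k x y * dy_g l i j x y.

Definition chern (i j k : 'I_n) (x y : 'rV[R]_n) : R :=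
  2^-1 * \sum_s ginv x y i s *
    (delta_g k s j x y - delta_g s j k x y + delta_g j k s x y).

End ChernConnection.

(* Finsler metrics are considered on a domain [D]: [D p] is the set of tangent
   vectors at [p] where [F p] is considered. *)
Section Finsler.
Context {R : realType} {T : topologicalType} {n : nat}.
Variables (S : smooth_structure R T n) (D : T -> set 'rV[R]_n).
Variable F : T -> 'rV[R]_n -> R.

Definition dom_in (c : chart R T n) (x : 'rV[R]_n) : set 'rV[R]_n :=
  [set y | D (cinv c x) (from_chart S c x y)].

Definition metric_in (c : chart R T n) (x y : 'rV[R]_n) : R :=
  F (cinv c x) (from_chart S c x y).

Definition finsler_metric : Prop :=
  [/\ forall c, atlas S c -> smooth_on
        [set w : 'rV[R]_(n + n) | cimg c (lsubmx w) /\
                                  dom_in c (lsubmx w) (rsubmx w)]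
        (fun w => metric_in c (lsubmx w) (rsubmx w) : R),
      forall p y (t : R), D p y -> 0 < t -> F p (t *: y) = t * F p y &
      forall p y u, D p y -> u != 0 -> 0 < fundamental_tensor (F p) y u u].

Definition berwald_type : Prop :=
  forall c x y y', atlas S c -> cimg c x -> dom_in c x y -> dom_in c x y' ->
    forall i j k, chern (metric_in c) i j k x y = chern (metric_in c) i j k x y'.

End Finsler.

Section Homogeneous.
Context {R : realType} {G : topGroupType} {d n : nat} {H : closed_subgroup G}.
Variables (SG : smooth_structure R G d).
Variable SM : smooth_structure R (coset_space H) n.

Definition invariant_metric (a : coset_space H -> 'M[R]_n) : Prop :=
  forall g p u v,
    inner (a (coset_act g p)) (mdiff SM SM (coset_act g) p u)
                              (mdiff SM SM (coset_act g) p v) =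
    inner (a p) u v.

Definition invariant_field (X : coset_space H -> 'rV[R]_n) : Prop :=
  forall g p, X (coset_act g p) = mdiff SM SM (coset_act g) p (X p).

Definition invariant_finsler (D : coset_space H -> set 'rV[R]_n)
    (F : coset_space H -> 'rV[R]_n -> R) : Prop :=
  forall g p y, D p y ->
    D (coset_act g p) (mdiff SM SM (coset_act g) p y) /\
    F (coset_act g p) (mdiff SM SM (coset_act g) p y) = F p y.

(* The differential of the projection at 1; it identifies q with the tangent
   space at the base point when g = h + q. *)
Definition tangent_proj : 'rV[R]_d -> 'rV[R]_n :=
  mdiff SG SM (@coset_proj G H) 1%g.

Definition riemannian_naturally_reductive (a : coset_space H -> 'M[R]_n) :
    Prop :=
  let ip u v := inner (a (base_point H)) (tangent_proj u) (tangent_proj v) in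
  exists h q : {vspace 'rV[R]_d}, reductive_decomposition SG H h q /\
    forall z u v, z \in q -> u \in q -> v \in q ->
      ip (bracket_proj SG h q z u) v + ip u (bracket_proj SG h q z v) = 0.

Definition finsler_naturally_reductive (D : coset_space H -> set 'rV[R]_n)
    (F : coset_space H -> 'rV[R]_n -> R) : Prop :=
  let f w := F (base_point H) (tangent_proj w) in
  exists h q : {vspace 'rV[R]_d}, reductive_decomposition SG H h q /\
    forall y z u v, y \in q -> y != 0 -> D (base_point H) (tangent_proj y) ->
      z \in q -> u \in q -> v \in q ->
      fundamental_tensor f y (bracket_proj SG h q z u) v +
      fundamental_tensor f y (bracket_proj SG h q z v) u +
      2 * cartan_tensor f y (bracket_proj SG h q z y) u v = 0.

End Homogeneous.

Section Kropina.
Context {R : realType} {T : Type} {n : nat}.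
Variables (a : T -> 'M[R]_n) (X : T -> 'rV[R]_n).

Definition kropina_dom (p : T) : set 'rV[R]_n :=
  [set y | 0 < inner (a p) (X p) y].

Definition kropina (m : R) (p : T) (y : 'rV[R]_n) : R :=
  Num.sqrt (inner (a p) y y) `^ (m + 1) / inner (a p) (X p) y `^ m.

End Kropina.

(* Main.v *)
(* With P = F^2 = alpha^(2m+2) beta^(-2m), the Finsler condition of natural
   reductivity is half the second derivative, in the directions u and v, of
   y |-> dP_y([z, y]_m), so by homogeneity it says that dP_y([z, y]_m) = 0, i.e.
     (m+1) <[z,y]_m, y> beta(y) = m alpha(y)^2 beta([z,y]_m).
   Restricted to the lines y = X + t w with beta(w) = 0, this is an identity
   between cubic polynomials in t and forces <[z,y]_m, y> = 0, the Riemannian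
   condition.  Conversely, the Riemannian condition gives the Finsler one as soon
   as beta([z,y]_m) = 0.

   The latter is where the Berwald property enters.  Contracting the definition
   of the Chern connection twice with y yields d_k P(y) = dP_y(Gamma_k y), where
   Gamma_k does not depend on y; as |X| is constant, the same cubic identity
   shows that beta is parallel for Gamma, hence closed since Gamma is symmetric.
   The pullback of beta to G is thus a closed left-invariant 1-form, and such a
   form vanishes on brackets. *)

Require Import Defs.
From HB Require Import structures.
From mathcomp Require Import all_boot all_order all_algebra.
From mathcomp Require Import all_classical all_reals all_analysis.
From mathcomp Require Import ring lra.

Set Implicit Arguments.
Unset Strict Implicit.
Unset Printing Implicit Defensive.

Import Order.TTheory GRing.Theory Num.Theory.
Import numFieldNormedType.Exports.

Local Open Scope classical_set_scope.
Local Open Scope ring_scope.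

(** * Differentials and symmetry of second derivatives *)

(** Both directions keep the same reductive decomposition. The lines [X + t w] are chosen because
    beta is constant on them, equal to |X|^2 > 0: they stay in the domain for every t, and both
    sides become polynomials in t, of degree at most 2 and 3, whose coefficients can be compared for
    any real m. The metric enters through log F^2 = (m+1) log alpha^2 - 2m log beta. Every
    y-derivative of F^2 is then F^2 times a rational function, and the homogeneity identities are
    checked on these closed formulas. In the Berwald half the nonlinear connection is never
    computed: it only multiplies y-derivatives of g, that is Cartan tensors, and these vanish on the
    pair (y, y). Closedness of beta is used only at the base point, since the pullback is constant
    on left-invariant fields near 1. The obstacle is that tangent vectors are recorded in preferred
    charts which may change from point to point, so all derivatives are first moved to two fixed
    charts, at 1 and at the base point. There the derivative of the form paired with a field splits
    into a symmetric bilinear part, which cancels, and a part that produces the bracket. *)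

Section Calculus.
Context {R : realType} {V W : normedModType R}.

(* ['d f x] is the junk value 0 when [f] is not differentiable at [x]. *)
Lemma diff_neq0_differentiable (f : V -> W) x v :
  'd f x v != 0 -> differentiable f x.
Proof.
move=> nz; apply: contrapT => ndf.
suff d0 : 'd f x v = 0 by rewrite d0 eqxx in nz.
rewrite /diff getPN //= => df [dfc dfE]; apply: ndf.
apply/diffP; apply: (@getPex _ (fun df : {linear V -> W} => continuous df /\
  forall y, f y = f (lim (nbhs x)) + df (y - lim (nbhs x))
                  +o_(y \near x) (y - lim (nbhs x)))).
by exists df.
Qed.

Lemma near_eq_differentiable (f g : V -> W) x :
  {near x, f =1 g} -> differentiable f x ->
  differentiable g x /\ 'd g x = 'd f x :> (V -> W).
Proof.
move=> fg df.
have gx : f x = g x := nbhs_singleton fg.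
have E : g \o shift x = cst (g x) + 'd f x +o_ 0 id.
  apply/eqaddoP => e e0.
  have /eqaddoP/(_ e e0) := diff_locally df.
  have fg0 : \forall y \near 0, f (y + x) = g (y + x).
    by have := fg; rewrite (near_shift 0 x) /=; apply: filterS => y /=; rewrite subr0.
  by apply: filter_app; near=> y; rewrite !fctE /= -gx (near fg0 y).
have dgE := diff_unique (diff_continuous df) E.
by split => //; apply/diff_locallyP; rewrite dgE; split => //; exact: diff_continuous.
Unshelve. all: by end_near. Qed.

End Calculus.

Section Schwarz.
Context {R : realType} {V : normedModType R}.

Definition second_difference (f : V -> R) x u v (h : R) :=
  f (x + h *: u + h *: v) - f (x + h *: u) - f (x + h *: v) + f x.

(** The mean value theorem along [u] turns the second difference into [h] times an increment of
    ['D_u f] along [v], and differentiability of ['D_u f] at [x] evaluates that increment. Its two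
    errors occur at displacements of norm at most [h (|u| + |v|)] and [h |u|], whence the constant
    [2 |u| + |v|]. *)
Lemma second_difference_lim (f : V -> R) x u v e :
  (\forall y \near x, derivable f y u) -> differentiable ('D_u f) x -> 0 < e ->
  \forall h \near 0^'+, `|second_difference f x u v h -
     h ^+ 2 * 'D_v ('D_u f) x| <= e * (2 * `|u| + `|v|) * h ^+ 2.
Proof.
move=> fu dg e0; rewrite deriveE //.
have /eqaddoP/(_ e e0) := diff_locally dg.
rewrite near_simpl => /nbhs_ballP[r1 /= r10 B1].
move: fu => /nbhs_ballP[r2 /= r20 B2].
pose K := `|u| + `|v| + 1.
have K0 : 0 < K by rewrite /K; have := normr_ge0 u; have := normr_ge0 v; lra.
near=> h.
have h0 : 0 < h by near: h; exact: nbhs_right_gt.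
have hr1 : h * K < r1.
  rewrite -ltr_pdivlMr //; near: h; apply: nbhs_right_lt; exact: divr_gt0.
have hr2 : h * K < r2.
  rewrite -ltr_pdivlMr //; near: h; apply: nbhs_right_lt; exact: divr_gt0.
have est t s : 0 <= t <= h -> 0 <= s <= h -> `|t *: u + s *: v| <= h * (`|u| + `|v|).
  move=> /andP[t0 th] /andP[s0 sh].
  rewrite (le_trans (ler_normD _ _)) // !normrZ !ger0_norm // mulrDr.
  by rewrite lerD // ler_wpM2r.
have est' t s : 0 <= t <= h -> 0 <= s <= h -> `|t *: u + s *: v| < h * K.
  move=> ht hs; apply: le_lt_trans (est _ _ ht hs) _.
  by rewrite ltr_pM2l // /K ltrDl.
have hh : 0 <= h <= h by rewrite lexx ltW.
have h00 : (0 : R) <= 0 <= h by rewrite lexx ltW.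
have der t s : 0 <= t <= h -> 0 <= s <= h ->
    is_derive t (1 : R) (fun t => f (x + t *: u + s *: v)) ('D_u f (x + t *: u + s *: v)).
  move=> ht hs.
  have /derivableP D : derivable f (x + t *: u + s *: v) u.
    apply: B2; rewrite -ball_normE /= -addrA opprD addNKr normrN.
    exact: lt_trans (est' _ _ ht hs) hr2.
  have Eq k : k^-1 *: (((fun t0 => f (x + t0 *: u + s *: v)) \o shift t) (k *: 1) -
        f (x + t *: u + s *: v)) =
    k^-1 *: ((f \o shift (x + t *: u + s *: v)) (k *: u) - f (x + t *: u + s *: v)).
    rewrite /= [k%:A]mulr1 scalerDl; congr (_ *: (f _ - _)).
    by rewrite (addrC (k *: u)) [RHS]addrC -!addrA; do 2 congr (_ + _); rewrite addrC.
  case: D => D _; split.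
  - by move: D; rewrite /derivable; under eq_fun do rewrite -Eq.
  - by rewrite /derive; under eq_fun do rewrite Eq.
(* The summand [0 *: v] puts both terms in the form [x + t *: u + s *: v] covered by [der]. *)
pose phi t := f (x + t *: u + h *: v) - f (x + t *: u + 0 *: v).
have [||c cin phiE] := @MVT R phi
  (fun t => 'D_u f (x + t *: u + h *: v) - 'D_u f (x + t *: u + 0 *: v)) 0 h h0.
- move=> t; rewrite in_itv /= => /andP[t0 th].
  have ht : 0 <= t <= h by rewrite !ltW.
  by apply: is_deriveB; exact: der.
- apply: continuous_in_subspaceT => t; rewrite inE /= in_itv /= => ht.
  apply: differentiable_continuous; apply/derivable1_diffP.
  by apply: ex_derive; apply: is_deriveB; exact: der.
move: cin; rewrite in_itv /= => /andP[c0 ch].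
have hc : 0 <= c <= h by rewrite !ltW.
have -> : second_difference f x u v h = phi h - phi 0.
  by rewrite /second_difference /phi !scale0r !addr0; ring.
rewrite phiE subr0 scale0r addr0.
have b1 s : 0 <= s <= h -> ball 0 r1 (c *: u + s *: v).
  move=> hs; rewrite -ball_normE /= sub0r normrN.
  exact: lt_trans (est' _ _ hc hs) hr1.
have {B1 b1} D s : 0 <= s <= h -> `|'D_u f (x + c *: u + s *: v) -
    ('D_u f x + 'd ('D_u f) x (c *: u + s *: v))| <= e * `|c *: u + s *: v|.
  move=> hs; have := B1 _ (b1 s hs).
  rewrite !fctE /= (addrC _ x) addrA; exact.
have := D h hh; have := D 0 h00; rewrite scale0r !addr0.
set g1 := 'D_u f (x + c *: u); set g2 := 'D_u f (x + c *: u + h *: v).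
have dD w1 w2 : 'd ('D_u f) x (w1 + w2) = 'd ('D_u f) x w1 + 'd ('D_u f) x w2.
  by rewrite linearD.
have dZ k w : 'd ('D_u f) x (k *: w) = k * 'd ('D_u f) x w by rewrite linearZ.
rewrite dD !dZ; set g := 'D_u f x; set du := 'd _ _ u; set dv := 'd _ _ v => Ea Eb.
have N1 : `|c *: u| <= h * `|u| by rewrite normrZ ger0_norm ?ler_wpM2r ?(ltW c0) // ltW.
have N2 := est c h hc hh.
have Ea' := le_trans Ea (ler_wpM2l (ltW e0) N1).
have Eb' := le_trans Eb (ler_wpM2l (ltW e0) N2).
rewrite (_ : (g2 - g1) * h - h ^+ 2 * dv =
  h * ((g2 - (g + (c * du + h * dv))) - (g1 - (g + c * du)))); last first.
  by ring.
rewrite normrM gtr0_norm // expr2 mulrA (mulrC _ h) ler_pM2l //.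
apply: le_trans (ler_normB _ _) _; apply: le_trans (lerD Eb' Ea') _.
by lra.
Unshelve. all: by end_near. Qed.

(** [second_difference] is symmetric in [u] and [v], so both mixed derivatives approximate the same
    number. The two error constants add up to [3 (|u| + |v|)], which explains [K]; its [+ 1] keeps
    it positive. *)
Lemma schwarz (f : V -> R) x u v :
  (\forall y \near x, derivable f y u) -> (\forall y \near x, derivable f y v) ->
  differentiable ('D_u f) x -> differentiable ('D_v f) x ->
  'D_v ('D_u f) x = 'D_u ('D_v f) x.
Proof.
move=> fu fv du dv; apply/eqP; rewrite -subr_eq0 -normr_le0.
apply/ler_addgt0Pr => e e0; rewrite add0r.
pose K := 3 * (`|u| + `|v|) + 1.
have K0 : 0 < K by rewrite /K; have := normr_ge0 u; have := normr_ge0 v; lra.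
have eK : 0 < e / K by exact: divr_gt0.
have N : \forall h \near (0 : R)^'+, `|'D_v ('D_u f) x - 'D_u ('D_v f) x| <= e.
  near=> h.
  have h0 : 0 < h by near: h; exact: nbhs_right_gt.
  have A : `|second_difference f x u v h - h ^+ 2 * 'D_v ('D_u f) x| <=
      e / K * (2 * `|u| + `|v|) * h ^+ 2.
    by near: h; exact: second_difference_lim.
  have B : `|second_difference f x v u h - h ^+ 2 * 'D_u ('D_v f) x| <=
      e / K * (2 * `|v| + `|u|) * h ^+ 2.
    by near: h; exact: second_difference_lim.
  have S : second_difference f x v u h = second_difference f x u v h.
    by rewrite /second_difference (addrAC x (h *: v)); ring.
  rewrite S in B.
  move: A B; set p := 'D_v _ _; set q := 'D_u _ _; set s := second_difference _ _ _ _ _ => A B.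
  have h2 : 0 < h ^+ 2 by rewrite exprn_gt0.
  have E : h ^+ 2 * `|p - q| <=
      e / K * (2 * `|v| + `|u|) * h ^+ 2 + e / K * (2 * `|u| + `|v|) * h ^+ 2.
    rewrite -{1}(gtr0_norm h2) -normrM.
    have -> : h ^+ 2 * (p - q) = (s - h ^+ 2 * q) - (s - h ^+ 2 * p) by ring.
    by apply: le_trans (ler_normB _ _) _; apply: lerD.
  rewrite -(ler_pM2l h2); apply: le_trans E _.
  have -> : e / K * (2 * `|v| + `|u|) * h ^+ 2 + e / K * (2 * `|u| + `|v|) * h ^+ 2 =
    h ^+ 2 * (e / K * (3 * (`|u| + `|v|))) by ring.
  rewrite ler_pM2l // -mulrA ler_piMr ?(ltW e0) //.
  by rewrite ler_pdivrMl // mulr1 /K lerDl.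
by case: (filter_ex N).
Unshelve. all: by end_near. Qed.
End Schwarz.

(** * Fundamental and Cartan tensors of the m-Kropina metric *)

Section DirectionalDerivatives.
Context {R : realType}.

Lemma linear_rV_differentiable n (V : normedModType R)
  (f : {linear 'rV[R]_n -> V}) x : differentiable f x.
Proof.
have -> : (f : _ -> _) = fun w : 'rV[R]_n => \sum_(j < n) w 0 j *: f (delta_mx 0 j).
  apply/funext => w; rewrite {1}[w]row_sum_delta linear_sum.
  by apply: eq_bigr => j _; rewrite linearZ.
have -> : (fun w : 'rV[R]_n => \sum_(j < n) w 0 j *: f (delta_mx 0 j)) =
  \sum_(j < n) (fun w : 'rV[R]_n => w 0 j *: f (delta_mx 0 j)).
  by apply/funext => w; rewrite fct_sumE.
apply: differentiable_sum => j; apply: differentiableZl; exact: differentiable_coord.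
Qed.

(** Reduces a directional derivative to a derivative in one real variable at 0, where the
    one-variable rules apply. *)
Lemma is_derive_line (V W : normedModType R) (f : V -> W) x v df :
  is_derive x v f df <-> is_derive (0 : R) (1 : R) (fun h => f (h *: v + x)) df.
Proof.
have E : (fun h : R => h^-1 *:
    (((fun h => f (h *: v + x)) \o shift 0) (h *: 1) - f (0 *: v + x))) =
         (fun h => h^-1 *: ((f \o shift x) (h *: v) - f x)).
  by apply/funext => h /=; rewrite addr0 scale0r add0r [_%:A]mulr1.
by split=> -[D1 D2]; split; [move: D1|move: D2|move: D1|move: D2]; rewrite /derivable /derive E.
Qed.

Lemma is_derive_linear (V W : normedModType R) (f : {linear V -> W}) x v :
  is_derive x v f (f v).
Proof.
apply/is_derive_line.
have -> : (fun h : R => f (h *: v + x)) = (fun h => h *: f v) + cst (f x).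
  by apply/funext => h; rewrite linearD linearZ.
rewrite -[X in is_derive _ _ _ X]addr0.
apply: is_deriveD; have [d e] := is_diff_scalel (0 : R) (f v).
apply: DeriveDef; first exact/derivable1_diffP.
by rewrite deriveE // e scale1r.
Qed.

Lemma is_derive_comp_R (V : normedModType R) (g : R -> R) (f : V -> R) x v df dg :
  is_derive x v f df -> is_derive (f x) (1 : R) g dg ->
  is_derive x v (g \o f) (dg * df).
Proof.
move=> /is_derive_line H1 Hg; apply/is_derive_line.
have Hg' : is_derive (f (0 *: v + x)) (1 : R) g dg by rewrite scale0r add0r.
exact: (is_derive1_comp Hg' H1).
Qed.

Lemma derive_comp_linear (V W Z : normedModType R) (L : {linear V -> W})
  (f : W -> Z) x v : 'D_v (f \o L) x = 'D_(L v) f (L x).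
Proof.
by rewrite /derive; under eq_fun do rewrite /= linearP.
Qed.

(** The difference quotients on both sides coincide. With the differential of the projection as [L],
    this carries the tensors on the Lie algebra to those on the tangent space at the base point. *)
Lemma fundamental_tensor_comp (V W : normedModType R) (L : {linear V -> W})
  (f : W -> R) y u v :
  fundamental_tensor (f \o L) y u v = fundamental_tensor f (L y) (L u) (L v).
Proof.
rewrite /fundamental_tensor -derive_comp_linear.
have -> // : 'D_v (fun w : V => (f \o L) w ^+ 2 : R) = 'D_(L v) (fun w => f w ^+ 2 : R) \o L.
by apply/funext => w; rewrite [RHS]/= -derive_comp_linear.
Qed.

Lemma cartan_tensor_comp (V W : normedModType R) (L : {linear V -> W})
  (f : W -> R) y z u v :
  cartan_tensor (f \o L) y z u v = cartan_tensor f (L y) (L z) (L u) (L v).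
Proof.
rewrite /cartan_tensor -derive_comp_linear.
have -> // : (fun w => fundamental_tensor (f \o L) w z u) =
  (fun w => fundamental_tensor f w (L z) (L u)) \o L.
by apply/funext => w /=; rewrite fundamental_tensor_comp.
Qed.

End DirectionalDerivatives.

Section Inner.
Context {R : realType} {n : nat}.
Variable M : 'M[R]_n.

Lemma innerDl u v w : inner M (u + v) w = inner M u w + inner M v w.
Proof. by rewrite /inner !mulmxDl mxE. Qed.
Lemma innerDr u v w : inner M u (v + w) = inner M u v + inner M u w.
Proof. by rewrite /inner linearD mulmxDr mxE. Qed.
Lemma innerZl k u v : inner M (k *: u) v = k * inner M u v.
Proof. by rewrite /inner -!scalemxAl mxE. Qed.
Lemma innerZr k u v : inner M u (k *: v) = k * inner M u v.
Proof. by rewrite /inner linearZ -scalemxAr mxE. Qed.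
Lemma inner_sym u v : M^T = M -> inner M u v = inner M v u.
Proof.
move=> Ms; rewrite /inner.
have -> : v *m M *m u^T = (u *m M *m v^T)^T by rewrite !trmx_mul trmxK Ms mulmxA.
by rewrite [RHS]mxE.
Qed.
Lemma inner_is_linear u : linear (inner M u).
Proof. by move=> k v w; rewrite innerDr innerZr. Qed.
HB.instance Definition _ u :=
  GRing.isLinear.Build R 'rV[R]_n R _ (inner M u) (inner_is_linear u).
End Inner.

(** Squaring absorbs the square root. In exponential form each derivative of [F ^+ 2] is [F ^+ 2]
    times a polynomial in derivatives of the exponent, which are rational. *)
Lemma kropina_sqr (R : realType) (m A B : R) : 0 < A -> 0 < B ->
  (Num.sqrt A `^ (m + 1) / B `^ m) ^+ 2 = expR ((m + 1) * ln A - 2 * m * ln B).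
Proof.
move=> A0 B0; have sA0 : 0 < Num.sqrt A by rewrite sqrtr_gt0.
rewrite expr_div_n !expr2 -!powRM ?sqrtr_ge0 ?ltW // -expr2 sqr_sqrtr ?ltW //.
rewrite expRD expRN /powR !gt_eqF ?mulr_gt0 // lnM ?posrE //.
by congr (_ / expR _); ring.
Qed.

Lemma is_derive_kropina_sqr (R : realType) (V : normedModType R) (A B : V -> R)
    (m : R) x v dA dB : 0 < A x -> 0 < B x ->
  is_derive x v A dA -> is_derive x v B dB ->
  is_derive x v (fun z => expR ((m + 1) * ln (A z) - 2 * m * ln (B z)))
    (expR ((m + 1) * ln (A x) - 2 * m * ln (B x)) *
      ((m + 1) * (dA / A x) - 2 * m * (dB / B x))).
Proof.
move=> A0 B0 HA HB; apply: (@is_derive_comp_R _ _ expR).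
have lA := is_derive_comp_R HA (is_derive1_ln A0).
have lB := is_derive_comp_R HB (is_derive1_ln B0).
have := is_deriveB (is_deriveZ (m + 1) lA) (is_deriveZ (2 * m) lB).
by rewrite (mulrC _ dA) (mulrC _ dB).
Qed.

Lemma is_derive_div (R : realType) (V : normedModType R) (f g : V -> R) x v df dg :
  is_derive x v f df -> is_derive x v g dg -> g x != 0 ->
  is_derive x v (fun z => f z / g z) ((df * g x - f x * dg) / g x ^+ 2).
Proof.
move=> Hf [g1 g2] gx.
have Hg : is_derive x v (fun z => (g z)^-1) (- g x ^- 2 *: dg).
  by apply: DeriveDef; [exact: derivableV|rewrite deriveV // g2].
apply: is_derive_eq (is_deriveM Hf Hg) _.
by rewrite /GRing.scale /=; field.
Qed.

Section KropinaDerivatives.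
Context {R : realType} {T : Type} {n : nat}.
Variables (a : T -> 'M[R]_n) (X : T -> 'rV[R]_n) (m : R) (p : T).
Hypothesis a_sym : (a p)^T = a p.
Hypothesis a_pos : forall v, v != 0 -> 0 < inner (a p) v v.
Local Notation q := (inner (a p)).
Local Notation b := (inner (a p) (X p)).
Local Notation K := (kropina a X m p).

Lemma kropina_dom_pos y : kropina_dom a X p y -> 0 < q y y.
Proof.
rewrite /kropina_dom /= => by0; apply: a_pos; apply: contraTneq by0 => ->.
by rewrite linear0 ltxx.
Qed.

(** Openness of the domain: closed formulas that hold only on it can be differentiated once more. *)
Lemma kropina_dom_near y : kropina_dom a X p y ->
  \forall w \near y, kropina_dom a X p w.
Proof.
move=> by0.
have /differentiable_continuous cb :=
  linear_rV_differentiable (inner (a p) (X p)) y.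
exact: (cb _ (lt_nbhsr by0)).
Qed.

Lemma is_derive_inner_sqr y v : is_derive y v (fun w => q w w) (2 * q y v).
Proof.
apply/is_derive_line.
have -> : (fun h : R => q (h *: v + y) (h *: v + y)) =
   (fun h => q v v * (h * h) + (2 * q y v) * h + q y y).
  apply/funext => h; rewrite innerDl !innerDr !innerZl !innerZr (inner_sym v y) //; ring.
have i := is_derive_id (0 : R) (1 : R).
have := is_deriveD (is_deriveD (is_deriveZ (q v v) (is_deriveM i i)) (is_deriveZ (2 * q y v) i))
  (is_derive_cst (q y y) (0 : R) 1).
move=> h; apply: is_derive_eq h _; rewrite /GRing.scale /=; ring.
Qed.

(** Write F^2 = exp phi with phi = (m+1) log <y,y> - 2m log beta(y). This and the next two
    definitions are the first, second and third differentials of phi at [y]. *)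
Definition dlog_kropina y v := 2 * (m + 1) * (q y v / q y y) - 2 * m * (b v / b y).

Definition d2log_kropina y u v :=
  2 * (m + 1) * (q u v / q y y - 2 * q y u * q y v / q y y ^+ 2)
  + 2 * m * (b u * b v / b y ^+ 2).

Definition d3log_kropina y z u v :=
  2 * (m + 1) * (8 * q y z * q y u * q y v / q y y ^+ 3
    - 2 * (q z u * q y v + q z v * q y u + q u v * q y z) / q y y ^+ 2)
  - 4 * m * (b z * b u * b v / b y ^+ 3).

Lemma kropina_sqr_gt0 y : kropina_dom a X p y -> 0 < K y ^+ 2.
Proof.
by move=> yD; rewrite kropina_sqr ?expR_gt0 //; exact: kropina_dom_pos.
Qed.

Lemma is_derive_kropina y v : kropina_dom a X p y ->
  is_derive y v (fun w => K w ^+ 2 : R) (K y ^+ 2 * dlog_kropina y v).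
Proof.
move=> yD; have yb := yD; have yq := kropina_dom_pos yD.
apply: (near_eq_is_derive (f :=
  fun w => expR ((m + 1) * ln (q w w) - 2 * m * ln (b w)))).
  by near=> w; rewrite kropina_sqr //; [apply: kropina_dom_pos|];
    near: w; exact: kropina_dom_near.
rewrite kropina_sqr //.
have h := @is_derive_kropina_sqr _ _ (fun w => q w w) b m _ _ _ _ yq yb
  (is_derive_inner_sqr y v) (is_derive_linear b y v).
apply: is_derive_eq h _.
by rewrite /dlog_kropina; congr (_ * _); ring.
Unshelve. all: by end_near. Qed.

Lemma is_derive_innerl y u v : is_derive y u (fun w => q w v) (q u v).
Proof.
under eq_fun do rewrite inner_sym //.
by rewrite inner_sym //; exact: is_derive_linear.
Qed.

Lemma is_derive_dlog_kropina y u v : kropina_dom a X p y ->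
  is_derive y u (fun w => dlog_kropina w v) (d2log_kropina y u v).
Proof.
move=> yD; have yb := yD; have yq := kropina_dom_pos yD.
have bn : b y != 0 by rewrite gt_eqF.
have qn : q y y != 0 by rewrite gt_eqF.
have h1 := is_derive_div (is_derive_innerl y u v) (is_derive_inner_sqr y u) qn.
have h2 := is_derive_div (is_derive_cst (b v) y u) (is_derive_linear b y u) bn.
have := is_deriveB (is_deriveZ (2 * (m + 1)) h1) (is_deriveZ (2 * m) h2).
move=> h; apply: is_derive_eq h _; rewrite /d2log_kropina /GRing.scale /=.
by field; rewrite bn qn.
Qed.

Lemma is_derive_d2log_kropina y z u v : kropina_dom a X p y ->
  is_derive y v (fun w => d2log_kropina w z u) (d3log_kropina y z u v).
Proof.
move=> yD; have yb := yD; have yq := kropina_dom_pos yD.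
have bn : b y != 0 by rewrite gt_eqF.
have qn : q y y != 0 by rewrite gt_eqF.
have h0 := is_derive_inner_sqr y v.
have h00 := is_deriveM h0 h0.
have h1 := is_derive_div (is_derive_cst (q z u) y v) h0 qn.
have qn2 : q y y ^+ 2 != 0 by rewrite expf_neq0.
have hz : is_derive y v (fun w => 2 * q w z) (2 * q v z) :=
  is_deriveZ 2 (is_derive_innerl y v z).
have h2 := is_derive_div (is_deriveM hz (is_derive_innerl y v u)) h00 qn2.
have hb := is_derive_linear b y v.
have bn2 : b y ^+ 2 != 0 by rewrite expf_neq0.
have h3 := is_derive_div (is_derive_cst (b z * b u) y v) (is_deriveM hb hb) bn2.
have := is_deriveD (is_deriveZ (2 * (m + 1)) (is_deriveB h1 h2)) (is_deriveZ (2 * m) h3).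
move=> h; apply: is_derive_eq h _.
rewrite /d3log_kropina !fctE !(inner_sym v) // /GRing.scale /=.
by field; rewrite bn qn.
Qed.

Lemma fundamental_tensor_kropina y u v : kropina_dom a X p y ->
  fundamental_tensor K y u v = 2^-1 * (K y ^+ 2 *
    (dlog_kropina y u * dlog_kropina y v + d2log_kropina y u v)).
Proof.
move=> yD; rewrite /fundamental_tensor.
congr (_ * _).
have h := is_deriveM (is_derive_kropina u yD) (is_derive_dlog_kropina u v yD).
have {}h := near_eq_is_derive (g := 'D_v (fun w => K w ^+ 2 : R)) _ h.
rewrite (@derive_val _ _ _ _ _ _ _ (h _)); last first.
  near=> w; apply/esym; apply: derive_val; apply: is_derive_kropina.
  by near: w; exact: kropina_dom_near.
by rewrite /GRing.scale /=; ring.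
Unshelve. all: by end_near. Qed.

(** The five terms are those of the third derivative of exp phi; [4^-1] is the product of the
    factors 1/2 of the two tensors. *)
Lemma cartan_tensor_kropina y z u v : kropina_dom a X p y ->
  cartan_tensor K y z u v = 4^-1 * (K y ^+ 2 *
    (dlog_kropina y z * dlog_kropina y u * dlog_kropina y v +
     d2log_kropina y z u * dlog_kropina y v +
     d2log_kropina y z v * dlog_kropina y u +
     d2log_kropina y u v * dlog_kropina y z +
     d3log_kropina y z u v)).
Proof.
move=> yD; rewrite /cartan_tensor.
have hp := is_derive_kropina v yD.
have h := is_deriveZ 2^-1 (is_deriveM hp (is_deriveD (is_deriveM
  (is_derive_dlog_kropina v z yD) (is_derive_dlog_kropina v u yD))
  (is_derive_d2log_kropina z u v yD))).
have {}h := near_eq_is_derive (g := fun w => fundamental_tensor K w z u : R) _ h.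
rewrite (@derive_val _ _ _ _ _ _ _ (h _)); last first.
  near=> w; rewrite fundamental_tensor_kropina //.
  by near: w; exact: kropina_dom_near.
rewrite !fctE /GRing.scale /=.
rewrite (_ : d2log_kropina y v z = d2log_kropina y z v); last first.
  by rewrite /d2log_kropina (inner_sym v z) //; ring.
rewrite (_ : d2log_kropina y v u = d2log_kropina y u v); last first.
  by rewrite /d2log_kropina (inner_sym v u) //; ring.
by field.
Unshelve. all: by end_near. Qed.

End KropinaDerivatives.

(** At t = 0 the two sides differ by [Q0 * c]. Then t = 1 and t = -1 isolate [Q2], and t = 1 and t =
    2 separate the cubic coefficient [m * al * l1] from the linear one. On the lines [X + t w], [c]
    is |X|^2 and [al] is |w|^2. *)
Lemma cubic_identity (R : realFieldType) (m c al Q0 Q1 Q2 l1 : R) :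
  m != 0 -> m + 1 != 0 -> c != 0 ->
  (forall t, (m + 1) * (Q0 + t * Q1 + t ^+ 2 * Q2) * c =
             m * (c + t ^+ 2 * al) * (Q0 + t * l1)) ->
  [/\ Q0 = 0, Q2 = 0, al * l1 = 0 & (m + 1) * Q1 = m * l1].
Proof.
move=> m0 m1 c0 H.
have Q00 : Q0 = 0.
  by apply: (mulfI c0); have := H 0; rewrite expr0n /=; lra.
subst Q0.
have H1 := H 1; have HN := H (-1); have H2 := H 2.
have Q20 : Q2 = 0.
  apply: (mulfI (mulf_neq0 m1 c0)); rewrite mulr0; move: H1 HN; nra.
subst Q2.
have al0 : al * l1 = 0.
  by apply: (mulfI m0); rewrite mulr0; move: H1 H2; lra.
split=> //; apply: (mulfI c0); move: H1 (congr1 ( *%R m) al0); lra.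
Qed.

(** * Pointwise identities for the fundamental and Cartan tensors *)

Section KropinaIdentities.
Context {R : realType} {T : Type} {n : nat}.
Variables (a : T -> 'M[R]_n) (X : T -> 'rV[R]_n) (m : R) (p : T).
Hypothesis a_sym : (a p)^T = a p.
Hypothesis a_pos : forall v, v != 0 -> 0 < inner (a p) v v.
Local Notation q := (inner (a p)).
Local Notation b := (inner (a p) (X p)).
Local Notation K := (kropina a X m p).
Local Notation dom := (kropina_dom a X p).

Lemma dom_neq0 y : dom y -> b y != 0 /\ q y y != 0.
Proof. move=> yD; split; rewrite gt_eqF //; exact: kropina_dom_pos yD. Qed.

Lemma fundamental_tensor_kropina_sym y u v : dom y ->
  fundamental_tensor K y u v = fundamental_tensor K y v u.
Proof.
move=> yD; rewrite !fundamental_tensor_kropina // /d2log_kropina (inner_sym u v) //.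
by ring.
Qed.

(** Iterated directional derivatives are not linear in the direction by definition; linearity is
    read off the closed formula. *)
Lemma fundamental_tensor_kropina_linear y v : dom y ->
  linear (fun u => fundamental_tensor K y u v).
Proof.
move=> yD k u w; rewrite !fundamental_tensor_kropina // /d2log_kropina /dlog_kropina.
rewrite !innerDr !innerZr innerDl innerZl /GRing.scale /=; ring.
Qed.

Lemma cartan_tensor_kropina_linear y u v : dom y ->
  linear (fun z => cartan_tensor K y z u v).
Proof.
move=> yD k z w; rewrite !cartan_tensor_kropina // /d3log_kropina /d2log_kropina /dlog_kropina.
rewrite !innerDr !innerZr !innerDl !innerZl /GRing.scale /=; ring.
Qed.

Lemma cartan_tensor_kropina_sym y z u v : dom y ->
  cartan_tensor K y z u v = cartan_tensor K y u z v.
Proof.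
move=> yD; rewrite !cartan_tensor_kropina // /d3log_kropina /d2log_kropina (inner_sym u z) //.
by ring.
Qed.

(** Euler's identity for the 2-homogeneous function [F ^+ 2]: the right-hand side is half of its
    differential. *)
Lemma fundamental_tensor_kropina_euler y v : dom y ->
  fundamental_tensor K y y v = 2^-1 * (K y ^+ 2 * dlog_kropina a X m p y v).
Proof.
move=> yD; have [bn qn] := dom_neq0 yD.
rewrite fundamental_tensor_kropina // /d2log_kropina /dlog_kropina; field.
by rewrite bn qn.
Qed.

Lemma fundamental_tensor_kropina_diag y : dom y ->
  fundamental_tensor K y y y = K y ^+ 2.
Proof.
move=> yD; have [bn qn] := dom_neq0 yD.
rewrite fundamental_tensor_kropina_euler // /dlog_kropina; field.
by rewrite bn qn.
Qed.

(** The fundamental tensor is 0-homogeneous in [y], so its derivative vanishes when contracted with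
    [y]. This is what removes the nonlinear connection from the contracted Chern connection. *)
Lemma cartan_tensor_kropina_euler y v : dom y -> cartan_tensor K y y y v = 0.
Proof.
move=> yD; have [bn qn] := dom_neq0 yD.
rewrite cartan_tensor_kropina // /d3log_kropina /d2log_kropina /dlog_kropina; field.
by rewrite bn qn.
Qed.

Lemma cartan_tensor_kropina_eulerr y w : dom y -> cartan_tensor K y w y y = 0.
Proof.
move=> yD; have [bn qn] := dom_neq0 yD.
rewrite cartan_tensor_kropina // /d3log_kropina /d2log_kropina /dlog_kropina.
rewrite !(inner_sym w y) //; field.
by rewrite bn qn.
Qed.

(* Differentiating the identity [d(F^2)_y [z, y] = 0] in the directions [u] and
   [v] gives the naturally reductive identity for the Finsler metric. *)
Lemma kropina_naturally_reductive y w u v wu wv : dom y ->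
  q w y = 0 -> q wu y + q u w = 0 -> q wv y + q v w = 0 ->
  q wu v + q u wv = 0 -> b w = 0 -> b wu = 0 -> b wv = 0 ->
  fundamental_tensor K y wu v + fundamental_tensor K y wv u
  + 2 * cartan_tensor K y w u v = 0.
Proof.
move=> yD wy uy vy uv bw bu bv; have [bn qn] := dom_neq0 yD.
have {}uy : q u w = - q wu y by lra.
have {}vy : q v w = - q wv y by lra.
have {}uv : q wv u = - q wu v by rewrite inner_sym //; lra.
rewrite !fundamental_tensor_kropina // cartan_tensor_kropina //.
rewrite /d3log_kropina /d2log_kropina /dlog_kropina bw bu bv.
rewrite !(inner_sym w) // !(inner_sym y wu) // !(inner_sym y wv) // uy vy uv.
by rewrite (inner_sym y w) // wy; field; rewrite bn qn.
Qed.

Lemma kropina_dlog_eq0 y w : dom y -> dlog_kropina a X m p y w = 0 ->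
  (m + 1) * q w y * b y = m * q y y * b w.
Proof.
move=> yD; have [bn qn] := dom_neq0 yD; rewrite /dlog_kropina => E.
have : 2^-1 * (b y * q y y) * 0 = 0 by rewrite mulr0.
rewrite -{1}E => /eqP; rewrite (inner_sym w y) // => /eqP E'.
have <- : 2^-1 * (b y * q y y) *
    (2 * (m + 1) * (q y w / q y y) - 2 * m * (b w / b y)) + m * q y y * b w =
  (m + 1) * q y w * b y.
  by field; rewrite bn qn.
by rewrite E' add0r.
Qed.

End KropinaIdentities.

(** * Berwald m-Kropina metrics in a chart *)

Lemma innerE (R : realType) n (M : 'M[R]_n) u v :
  inner M u v = \sum_i \sum_j u 0 i * M i j * v 0 j.
Proof.
rewrite /inner mxE exchange_big /=; apply: eq_bigr => j _.
by rewrite !mxE mulr_suml.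
Qed.

Lemma is_derive_coord (R : realType) (V : normedModType R) n
    (u : V -> 'rV[R]_n) x v du i : is_derive x v u du ->
  is_derive x v (fun z => u z 0 i) (du 0 i).
Proof.
move=> [u1 u2]; have := u1 => /derivable_mxP/(_ 0 i) ui; apply: DeriveDef => //.
by rewrite -u2 derive_mx // mxE.
Qed.

Section InnerCalculus.
Context {R : realType} {V : normedModType R} {n : nat}.
Variables (M : V -> 'M[R]_n) (u w : V -> 'rV[R]_n) (x : V).

Lemma is_derive_inner v (dM : 'M[R]_n) du dw :
  (forall i j, is_derive x v (fun z => M z i j) (dM i j)) ->
  is_derive x v u du -> is_derive x v w dw ->
  is_derive x v (fun z => inner (M z) (u z) (w z))
    (inner dM (u x) (w x) + inner (M x) du (w x) + inner (M x) (u x) dw).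
Proof.
move=> HM Hu Hw.
have -> : (fun z => inner (M z) (u z) (w z)) =
   \sum_i \sum_j (fun z => u z 0 i * M z i j * w z 0 j).
  apply/funext => z; rewrite innerE fct_sumE; apply: eq_bigr => i _.
  by rewrite fct_sumE.
rewrite !innerE -!big_split /=; apply: is_derive_sum => i.
rewrite -!big_split /=; apply: is_derive_sum => j.
have h := is_deriveM (is_deriveM (is_derive_coord i Hu) (HM i j)) (is_derive_coord j Hw).
by apply: is_derive_eq h _; rewrite !fctE /GRing.scale /=; ring.
Qed.

Lemma differentiable_inner :
  (forall i j, differentiable (fun z => M z i j) x) ->
  differentiable u x -> differentiable w x ->
  differentiable (fun z => inner (M z) (u z) (w z)) x.
Proof.
move=> HM Hu Hw.
have -> : (fun z => inner (M z) (u z) (w z)) =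
   \sum_i \sum_j (fun z => u z 0 i * M z i j * w z 0 j).
  apply/funext => z; rewrite innerE fct_sumE; apply: eq_bigr => i _.
  by rewrite fct_sumE.
have coord (g : V -> 'rV[R]_n) i : differentiable g x -> differentiable (fun z => g z 0 i) x.
  move=> dg; apply: (@differentiable_comp _ _ _ _ g (fun r : 'rV[R]_n => r 0 i)) => //.
  exact: differentiable_coord.
apply: differentiable_sum => i; apply: differentiable_sum => j.
by apply: differentiableM; [apply: differentiableM|]; [exact: coord| |exact: coord].
Qed.

End InnerCalculus.

Section KropinaContractions.
Context {R : realType} {T : Type} {n : nat}.
Variables (a : T -> 'M[R]_n) (X : T -> 'rV[R]_n) (m : R) (p : T).
Hypothesis a_sym : (a p)^T = a p.
Hypothesis a_pos : forall v, v != 0 -> 0 < inner (a p) v v.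
Local Notation K := (kropina a X m p).
Local Notation e i := (delta_mx 0 i : 'rV[R]_n).

Lemma linear_row_sum (f : 'rV[R]_n -> R) (u : 'rV[R]_n) : linear f ->
  \sum_i u 0 i * f (e i) = f u.
Proof.
move=> fl; pose g : {linear 'rV[R]_n -> R^o} := HB.pack f (GRing.isLinear.Build _ _ _ _ f fl).
rewrite -[f]/(g : _ -> _) {2}[u]row_sum_delta linear_sum.
by apply: eq_bigr => i _; rewrite linearZ_LR.
Qed.

Lemma bilinear_row_sum (f : 'rV[R]_n -> 'rV[R]_n -> R) (u v : 'rV[R]_n) :
  (forall w, linear (f^~ w)) -> (forall w, linear (f w)) ->
  \sum_i \sum_j u 0 i * v 0 j * f (e i) (e j) = f u v.
Proof.
move=> fl fr; rewrite -(linear_row_sum u (fl v)); apply: eq_bigr => i _.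
rewrite -(linear_row_sum v (fr _)) mulr_sumr.
by apply: eq_bigr => j _; rewrite mulrA.
Qed.

Lemma fundamental_tensor_kropina_sum y (u v : 'rV[R]_n) : kropina_dom a X p y ->
  \sum_i \sum_j u 0 i * v 0 j * fundamental_tensor K y (e i) (e j) =
  fundamental_tensor K y u v.
Proof.
move=> yD; apply: bilinear_row_sum => w; first exact: fundamental_tensor_kropina_linear.
move=> k s t; rewrite !(fundamental_tensor_kropina_sym m a_sym a_pos w _ yD).
exact: fundamental_tensor_kropina_linear.
Qed.

Lemma cartan_tensor_kropina_sum y (u v w : 'rV[R]_n) : kropina_dom a X p y ->
  \sum_i \sum_j u 0 i * v 0 j * cartan_tensor K y (e i) (e j) w =
  cartan_tensor K y u v w.
Proof.
move=> yD; apply: (bilinear_row_sum (f := fun u v => cartan_tensor K y u v w)) => z.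
  exact: cartan_tensor_kropina_linear.
move=> k s t; rewrite !(cartan_tensor_kropina_sym m a_sym a_pos z _ w yD).
exact: cartan_tensor_kropina_linear.
Qed.

End KropinaContractions.

(** * The Chern connection of an m-Kropina metric in one chart *)

Section LocalBerwald.
Context {R : realType} {n : nat}.
Variables (F : 'rV[R]_n -> 'rV[R]_n -> R) (a : 'rV[R]_n -> 'M[R]_n).
Variables (X : 'rV[R]_n -> 'rV[R]_n) (m c : R) (x : 'rV[R]_n).
Hypothesis FE : \forall z \near x, F z = kropina a X m z.
Hypothesis a_sym : \forall z \near x, (a z)^T = a z.
Hypothesis a_pos : \forall z \near x, forall v, v != 0 -> 0 < inner (a z) v v.
Hypothesis a_diff : forall i j, differentiable (fun z => a z i j) x.
Hypothesis X_diff : differentiable X x.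
Hypothesis c_gt0 : 0 < c.
Hypothesis X_norm : \forall z \near x, inner (a z) (X z) (X z) = c.
Hypothesis F_pos : forall y u, kropina_dom a X x y -> u != 0 ->
  0 < fundamental_tensor (F x) y u u.
Hypothesis m_neq0 : m != 0.
Hypothesis m_neqN1 : m + 1 != 0.
Local Notation e i := (delta_mx 0 i : 'rV[R]_n).
Local Notation q := (inner (a x)).
Local Notation b := (inner (a x) (X x)).
Local Notation dom := (kropina_dom a X x).

Let Fx : F x = kropina a X m x := nbhs_singleton FE.
Let sx : (a x)^T = a x := nbhs_singleton a_sym.
Let px : forall v, v != 0 -> 0 < q v v := nbhs_singleton a_pos.

Let da k : 'M[R]_n := \matrix_(i, j) 'D_(e k) (fun z => a z i j) x.
Let dX k : 'rV[R]_n := 'D_(e k) X x.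
Let db k v := inner (da k) (X x) v + q (dX k) v.

Lemma is_derive_a k i j : is_derive x (e k) (fun z => a z i j) (da k i j).
Proof. by rewrite mxE; apply: derivableP; exact: diff_derivable. Qed.

Lemma is_derive_inner_x k u v :
  is_derive x (e k) (fun z => inner (a z) u v) (inner (da k) u v).
Proof.
have h := is_derive_inner (is_derive_a k) (is_derive_cst u x (e k)) (is_derive_cst v x (e k)).
by apply: is_derive_eq h _; rewrite (inner_sym 0) // !linear0 !addr0.
Qed.

Lemma is_derive_form_x k v :
  is_derive x (e k) (fun z => inner (a z) (X z) v) (db k v).
Proof.
have hX : is_derive x (e k) X (dX k) by apply: derivableP; exact: diff_derivable.
have h := is_derive_inner (is_derive_a k) hX (is_derive_cst v x (e k)).
by apply: is_derive_eq h _; rewrite !linear0 !addr0.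
Qed.

Lemma dom_near_x y : dom y -> \forall z \near x, kropina_dom a X z y.
Proof.
move=> yD.
have /differentiable_continuous cb : differentiable (fun z => inner (a z) (X z) y) x.
  by apply: differentiable_inner.
exact: (cb _ (lt_nbhsr yD)).
Qed.

Lemma is_derive_kropina_x k y : dom y ->
  is_derive x (e k) (fun z => F z y ^+ 2 : R)
    (F x y ^+ 2 * ((m + 1) * (inner (da k) y y / q y y) - 2 * m * (db k y / b y))).
Proof.
move=> yD; have yq := kropina_dom_pos px yD; rewrite Fx.
apply: (near_eq_is_derive (f := fun z => expR ((m + 1) * ln (inner (a z) y y)
    - 2 * m * ln (inner (a z) (X z) y)))).
  near=> z; rewrite (near FE z) // kropina_sqr //; last by near: z; exact: dom_near_x.
  apply: (@kropina_dom_pos _ _ _ a X); first exact: (near a_pos z).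
  by near: z; exact: dom_near_x.
rewrite kropina_sqr //.
exact: (@is_derive_kropina_sqr _ _ (fun z => inner (a z) y y)
   (fun z => inner (a z) (X z) y) _ _ _ _ _ yq yD (is_derive_inner_x k y y) (is_derive_form_x k y)).
Unshelve. all: by end_near. Qed.

Lemma gmx_near y i j : dom y -> \forall z \near x,
  gmx F z y i j = 2^-1 * (expR ((m + 1) * ln (inner (a z) y y)
    - 2 * m * ln (inner (a z) (X z) y)) *
   (dlog_kropina a X m z y (e i) * dlog_kropina a X m z y (e j) +
    d2log_kropina a X m z y (e i) (e j))).
Proof.
move=> yD; near=> z.
have zD : kropina_dom a X z y by near: z; exact: dom_near_x.
have zp : forall v, v != 0 -> 0 < inner (a z) v v by exact: (near a_pos z).
rewrite mxE (near FE z) // fundamental_tensor_kropina //; last exact: (near a_sym z).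
by rewrite kropina_sqr //; exact: (@kropina_dom_pos _ _ _ a X).
Unshelve. all: by end_near. Qed.

(** [dx_g] is a directional derivative of each single entry, so moving it through a sum over entries
    requires every entry to be derivable. The formula of [gmx_near] provides this; the value of the
    derivative is left implicit. *)
Lemma gmx_derivable k y i j : dom y -> derivable (fun z => gmx F z y i j) x (e k).
Proof.
move=> yD; have [bn qn] := dom_neq0 px yD; have yq := kropina_dom_pos px yD.
have q2 := is_deriveM (is_derive_inner_x k y y) (is_derive_inner_x k y y).
have b2 := is_deriveM (is_derive_form_x k y) (is_derive_form_x k y).
have D v := is_deriveB
  (is_deriveZ (2 * (m + 1)) (is_derive_div (is_derive_inner_x k y v) (is_derive_inner_x k y y) qn))
  (is_deriveZ (2 * m) (is_derive_div (is_derive_form_x k v) (is_derive_form_x k y) bn)).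
have qi : is_derive x (e k) (fun z => 2 * inner (a z) y (e i)) _ :=
  is_deriveZ 2 (is_derive_inner_x k y (e i)).
have D2 := is_deriveD (is_deriveZ (2 * (m + 1)) (is_deriveB
  (is_derive_div (is_derive_inner_x k (e i) (e j)) (is_derive_inner_x k y y) qn)
  (is_derive_div (is_deriveM qi (is_derive_inner_x k y (e j))) q2 (mulf_neq0 qn qn))))
  (is_deriveZ (2 * m) (is_derive_div
    (is_deriveM (is_derive_form_x k (e i)) (is_derive_form_x k (e j))) b2 (mulf_neq0 bn bn))).
have P := @is_derive_kropina_sqr _ _ (fun z => inner (a z) y y)
   (fun z => inner (a z) (X z) y) m _ _ _ _ yq yD (is_derive_inner_x k y y) (is_derive_form_x k y).
have h := is_deriveZ 2^-1 (is_deriveM P (is_deriveD (is_deriveM (D (e i)) (D (e j))) D2)).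
apply: near_eq_derivable (@ex_derive _ _ _ _ _ _ _ h).
by near=> z; rewrite (near (gmx_near i j yD) z).
Unshelve. all: by end_near. Qed.

Lemma gmx_sym z y i j : (a z)^T = a z ->
  (forall v, v != 0 -> 0 < inner (a z) v v) -> F z = kropina a X m z ->
  kropina_dom a X z y -> gmx F z y i j = gmx F z y j i.
Proof. by move=> sz pz Fz yD; rewrite !mxE Fz; exact: fundamental_tensor_kropina_sym. Qed.

Lemma dx_g_sym k i j y : dom y -> dx_g F k i j x y = dx_g F k j i x y.
Proof.
move=> yD; apply: near_eq_derive; near=> z.
apply: gmx_sym; [exact: (near a_sym z)|exact: (near a_pos z)|exact: (near FE z)|].
by near: z; exact: dom_near_x.
Unshelve. all: by end_near. Qed.

Lemma dy_gE k i j y : dy_g F k i j x y = 2 * cartan_tensor (F x) y (e i) (e j) (e k).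
Proof.
rewrite /dy_g /cartan_tensor mulVKf //.
by under eq_fun do rewrite mxE.
Qed.

Lemma delta_g_sym k i j y : dom y -> delta_g F k i j x y = delta_g F k j i x y.
Proof.
move=> yD; rewrite /delta_g (dx_g_sym k i j yD); congr (_ - _); apply: eq_bigr => l _.
have -> // : dy_g F l i j x y = dy_g F l j i x y.
by rewrite !dy_gE Fx (cartan_tensor_kropina_sym m sx px _ _ _ yD).
Qed.

(** By homogeneity g(y, y) = F^2 at every nearby base point, and [y] is held fixed, so contraction
    and differentiation in the base point commute. *)
Lemma dx_g_contract k (y : 'rV[R]_n) : dom y ->
  \sum_i \sum_j y 0 i * y 0 j * dx_g F k i j x y =
  F x y ^+ 2 * ((m + 1) * (inner (da k) y y / q y y) - 2 * m * (db k y / b y)).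
Proof.
move=> yD; have [_ <-] := is_derive_kropina_x k yD.
have h : is_derive x (e k)
    (\sum_i \sum_j (fun z => y 0 i * y 0 j * gmx F z y i j))
    (\sum_i \sum_j y 0 i * y 0 j * dx_g F k i j x y).
  apply: is_derive_sum => i; apply: is_derive_sum => j.
  have := is_deriveZ (y 0 i * y 0 j)
    (derivableP (gmx_derivable (k := k) (i := i) (j := j) yD)).
  exact.
have [_ <-] := h; apply: near_eq_derive; near=> z.
have zD : kropina_dom a X z y by near: z; exact: dom_near_x.
have zs : (a z)^T = a z by exact: (near a_sym z).
have zp : forall v, v != 0 -> 0 < inner (a z) v v by exact: (near a_pos z).
have Fz : F z = kropina a X m z by exact: (near FE z).
rewrite Fz -(fundamental_tensor_kropina_diag m zs zp zD) -fundamental_tensor_kropina_sum //.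
rewrite fct_sumE; apply: eq_bigr => i _; rewrite fct_sumE; apply: eq_bigr => j _.
by rewrite mxE Fz.
Unshelve. all: by end_near. Qed.

(** The correction terms are connection coefficients times 2 C(y, y, e_l), and each of these is
    zero. *)
Lemma delta_g_contract k (y : 'rV[R]_n) : dom y ->
  \sum_i \sum_j y 0 i * y 0 j * delta_g F k i j x y =
  F x y ^+ 2 * ((m + 1) * (inner (da k) y y / q y y) - 2 * m * (db k y / b y)).
Proof.
move=> yD; rewrite -dx_g_contract // /delta_g.
under eq_bigr do under eq_bigr do rewrite mulrBr.
under eq_bigr do rewrite sumrB.
rewrite sumrB -[RHS]subr0; congr (_ - _).
under eq_bigr do under eq_bigr do rewrite mulr_sumr.
under eq_bigr do rewrite exchange_big /=.
rewrite exchange_big big1 // => l _.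
under eq_bigr do under eq_bigr do
  rewrite dy_gE !mulrA (mulrC _ (nonlinear_connection _ _ _ _ _)) -!mulrA.
under eq_bigr do rewrite -mulr_sumr.
rewrite -mulr_sumr.
under eq_bigr do under eq_bigr do rewrite mulrA mulrA (mulrC _ 2) -!mulrA (mulrA (y 0 _)).
under eq_bigr do rewrite -mulr_sumr.
by rewrite -mulr_sumr Fx cartan_tensor_kropina_sum // cartan_tensor_kropina_euler // !mulr0.
Qed.

(** Absence of torsion, from the symmetry of g in the three terms of the Christoffel-type
    formula. *)
Lemma chern_sym i j k y : dom y -> chern F i j k x y = chern F i k j x y.
Proof.
move=> yD; rewrite /chern; congr (_ * _); apply: eq_bigr => s _; congr (_ * _).
by rewrite (delta_g_sym k s j yD) (delta_g_sym s j k yD) (delta_g_sym j k s yD); ring.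
Qed.

(** A vector in the kernel of the matrix would be null for the positive definite fundamental
    tensor. *)
Lemma gmx_unit y : dom y -> gmx F x y \in unitmx.
Proof.
move=> yD; rewrite -row_free_unit -kermx_eq0; apply/rowV0P => u /sub_kermxP uG.
apply/eqP/negPn/negP => u0; have := F_pos yD u0.
rewrite Fx -(fundamental_tensor_kropina_sum m sx px _ _ yD) exchange_big big1 ?ltxx // => j _.
have := congr1 (fun r : 'rV[R]_n => r 0 j) uG; rewrite !mxE => /(congr1 ( *%R^~ (u 0 j))).
rewrite mul0r mulr_suml => E; rewrite -[RHS]E; apply: eq_bigr => i _.
by rewrite mxE Fx mulrAC.
Qed.

(** The connection matrix Gamma_k, taken at the direction [y], applied to [z]. Direction and vector
    are kept apart so that the Berwald property can freeze the former. *)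
Definition chern_vec k y (z : 'rV[R]_n) : 'rV[R]_n := \row_i \sum_j chern F i j k x y * z 0 j.

(** With its index lowered and contracted with y twice, Gamma_k leaves half of the contraction of
    delta_k g: the other two terms cancel after renaming indices. Euler's identity turns g(y, .)
    into half the differential of F^2, and dividing by F^2 gives logarithmic derivatives. *)
Lemma chern_contract k y : dom y ->
  dlog_kropina a X m x y (chern_vec k y y) =
  (m + 1) * (inner (da k) y y / q y y) - 2 * m * (db k y / b y).
Proof.
move=> yD; have P0 : 0 < F x y ^+ 2 by rewrite Fx; exact: kropina_sqr_gt0.
apply: (mulfI (lt0r_neq0 P0)).
rewrite -delta_g_contract //.
pose G := gmx F x y.
(* [Tm] is the parenthesis in the definition of [chern]; lowering the free index with [G] cancels
   the inverse matrix there. *)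
pose Tm : 'M[R]_n := \matrix_(s, j)
  (delta_g F k s j x y - delta_g F s j k x y + delta_g F j k s x y).
have chernE : (chern_vec k y y)^T = 2^-1 *: (invmx G *m Tm *m y^T).
  apply/matrixP => i z; rewrite ord1 !mxE mulr_sumr; apply: eq_bigr => j _.
  rewrite !mxE /chern mulrA; congr (_ * _ * _).
  by apply: eq_bigr => s _; rewrite mxE.
have yG v : inner G y v = fundamental_tensor (F x) y y v.
  rewrite innerE Fx -fundamental_tensor_kropina_sum //; apply: eq_bigr => i _.
  by apply: eq_bigr => j _; rewrite mxE Fx mulrAC.
have -> : F x y ^+ 2 * dlog_kropina a X m x y (chern_vec k y y) =
  2 * inner G y (chern_vec k y y).
  by rewrite yG Fx fundamental_tensor_kropina_euler // mulVKf.
rewrite /inner chernE -scalemxAr !mulmxA mulmxK ?gmx_unit // [X in 2 * X]mxE mulVKf //.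
rewrite -/(inner Tm y y) innerE.
have -> : \sum_i \sum_j y 0 i * Tm i j * y 0 j =
  \sum_i \sum_j y 0 i * y 0 j * delta_g F k i j x y -
  \sum_i \sum_j y 0 i * y 0 j * delta_g F i j k x y +
  \sum_i \sum_j y 0 i * y 0 j * delta_g F j k i x y.
  rewrite -sumrB -big_split; apply: eq_bigr => i _.
  by rewrite -sumrB -big_split; apply: eq_bigr => j _; rewrite mxE /=; ring.
rewrite [X in _ + X]exchange_big /= -addrA [X in _ + X](_ : _ = 0) ?addr0 //.
apply/eqP; rewrite addrC subr_eq0; apply/eqP; apply: eq_bigr => i _; apply: eq_bigr => j _.
by rewrite (delta_g_sym i k j yD) (mulrC (y 0 j)).
Qed.

Hypothesis F_berwald : forall y y', dom y -> dom y' ->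
  forall i j k, chern F i j k x y = chern F i j k x y'.

Let Xdom : dom (X x).
Proof. by rewrite /kropina_dom /= (nbhs_singleton X_norm). Qed.

Lemma chern_vec_dom k y z : dom y -> chern_vec k y z = chern_vec k (X x) z.
Proof.
move=> yD; apply/rowP => i; rewrite [LHS]mxE [RHS]mxE; apply: eq_bigr => j _.
by rewrite (F_berwald yD Xdom i j k).
Qed.

Lemma chern_vecD k y z w s :
  chern_vec k y (z + s *: w) = chern_vec k y z + s *: chern_vec k y w.
Proof.
apply/rowP => i; rewrite [LHS]mxE [RHS]mxE ![in RHS]mxE mulr_sumr -big_split /=.
by apply: eq_bigr => j _; rewrite !mxE; move: (chern _ _ _ _ _ _) => C; ring.
Qed.

(** Since beta(X) = c > 0, [X x] lies in the domain and serves as the reference direction. By the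
    Berwald property [L k] represents Gamma_k at every direction, so it is one fixed linear map. *)
Let L k z := chern_vec k (X x) z.

Lemma berwald_identity k y : dom y ->
  (m + 1) * (2^-1 * inner (da k) y y - q y (L k y)) * b y =
  m * q y y * (db k y - b (L k y)).
Proof.
move=> yD; have := chern_contract k yD; rewrite (chern_vec_dom k y yD) -/(L k y).
have [bn qn] := dom_neq0 px yD; rewrite /dlog_kropina => E.
apply/eqP; rewrite -subr_eq0; apply/eqP.
transitivity (2^-1 * (b y * q y y) *
  (((m + 1) * (inner (da k) y y / q y y) - 2 * m * (db k y / b y)) -
  (2 * (m + 1) * (q y (L k y) / q y y) - 2 * m * (b (L k y) / b y)))).
  by field; rewrite bn qn.
by rewrite E subrr mulr0.
Qed.

Lemma derive_norm k : inner (da k) (X x) (X x) + 2 * q (dX k) (X x) = 0.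
Proof.
have hX : is_derive x (e k) X (dX k) by apply: derivableP; exact: diff_derivable.
have [_ h] := is_derive_inner (is_derive_a k) hX hX.
have h0 := derive_cst c x (e k).
rewrite -h0 (near_eq_derive (g := fun z => inner (a z) (X z) (X z))) ?h; last first.
  by near=> z; rewrite (near X_norm z).
by rewrite (inner_sym (X x) (dX k)) //; ring.
Unshelve. all: by end_near. Qed.

(** Put Q(y) = (1/2) [inner (da k) y y] - <y, L y> and l(y) = [db k y] - beta(L y);
    [berwald_identity] reads (m+1) Q beta = m alpha^2 l. On [X + t w] with beta(w) = 0,
    [cubic_identity] gives l(X) = 0 and l(w) = 0, and these vectors span. *)
Lemma berwald_parallel k v : db k v = b (L k v).
Proof.
have cE : b (X x) = c := nbhs_singleton X_norm.
have da_sym u w : inner (da k) u w = inner (da k) w u.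
  rewrite inner_sym //; apply/matrixP => i j; rewrite !mxE; apply: near_eq_derive.
  by near=> z; rewrite -[in LHS](near a_sym z) // mxE.
have key w : b w = 0 -> b (L k (X x)) = db k (X x) /\ db k w = b (L k w).
  move=> bw.
  (* Constancy of |X| makes Q(X) = l(X), so that the constant terms on the two sides agree, as
     [cubic_identity] demands. *)
  have Q0 : 2^-1 * inner (da k) (X x) (X x) - q (X x) (L k (X x)) = db k (X x) - b (L k (X x)).
    have := derive_norm k; rewrite /db; lra.
  have := @cubic_identity _ m c (q w w)
    (db k (X x) - b (L k (X x)))
    (inner (da k) (X x) w - q (X x) (L k w) - q w (L k (X x)))
    (2^-1 * inner (da k) w w - q w (L k w)) (db k w - b (L k w))
    m_neq0 m_neqN1 (lt0r_neq0 c_gt0).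
  case=> [t|Qx _ /eqP ww _].
    have yD : dom (X x + t *: w).
      by rewrite /kropina_dom /= innerDr innerZr cE bw mulr0 addr0.
    have := berwald_identity k yD.
    have -> : L k (X x + t *: w) = L k (X x) + t *: L k w by exact: chern_vecD.
    have -> : db k (X x + t *: w) = db k (X x) + t * db k w.
      by rewrite /db !innerDr !innerZr; ring.
    rewrite !innerDr !innerZr !innerDl !innerZl.
    rewrite (inner_sym w (X x) sx) cE bw (da_sym w (X x)) => E.
    have -> : db k (X x) = 2^-1 * inner (da k) (X x) (X x) by lra.
    rewrite (_ : db k (X x) = 2^-1 * inner (da k) (X x) (X x)) in E; last by lra.
    transitivity ((m + 1) * (2^-1 * (inner (da k) (X x) (X x) + t * inner (da k) (X x) w +
      t * (inner (da k) (X x) w + t * inner (da k) w w)) -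
      (q (X x) (L k (X x)) + t * q w (L k (X x)) +
      t * (q (X x) (L k w) + t * q w (L k w)))) * (c + t * 0)); first by field.
    by rewrite E; ring.
  split; first by apply/esym/eqP; rewrite -subr_eq0 Qx.
  (* For [w = 0] the product [ww] carries no information, but then both sides vanish. *)
  move: ww; have [->|w0] := eqVneq w 0.
    have L0 : L k 0 = 0.
      by apply/rowP => i; rewrite [LHS]mxE [RHS]mxE big1 // => j _; rewrite mxE mulr0.
    by move=> _; rewrite /db L0 !linear0 addr0.
  by rewrite mulf_eq0 gt_eqF ?px // orFb subr_eq0 => /eqP.
have [LX _] : b (L k (X x)) = db k (X x) /\ db k 0 = b (L k 0) by apply: key; rewrite linear0.
(* Orthogonal decomposition of [v] along X: [s] is chosen so that beta(w) = 0. *)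
pose s := b v / c; pose w := v - s *: X x.
have bw : b w = 0.
  by rewrite /w -scaleNr innerDr innerZr cE mulNr divfK ?subrr // gt_eqF.
have [_ Lw] := key w bw.
have -> : v = w + s *: X x by rewrite subrK.
have -> : L k (w + s *: X x) = L k w + s *: L k (X x) by exact: chern_vecD.
have -> : db k (w + s *: X x) = db k w + s * db k (X x).
  by rewrite /db !innerDr !innerZr; ring.
by rewrite innerDr innerZr Lw LX.
Unshelve. all: by end_near. Qed.

(** A form parallel for a torsion-free connection is closed: both sides equal the sum over i of
    beta_i Gamma^i_jk. *)
Lemma berwald_closed j k :
  'D_(e k) (fun z => inner (a z) (X z) (e j)) x =
  'D_(e j) (fun z => inner (a z) (X z) (e k)) x.
Proof.
rewrite (@derive_val _ _ _ _ _ _ _ (is_derive_form_x k (e j))).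
rewrite (@derive_val _ _ _ _ _ _ _ (is_derive_form_x j (e k))) !berwald_parallel.
congr (b _); apply/rowP => i; rewrite [LHS]mxE [RHS]mxE.
have pick f l : \sum_l' f l' * (e l) 0 l' = f l :> R.
  rewrite (bigD1 l) //= big1 ?addr0 ?mxE ?eqxx ?mulr1 // => l' nl.
  by rewrite mxE (negbTE nl) andbF mulr0.
by rewrite !pick chern_sym.
Qed.

End LocalBerwald.

(** * Closed forms, charts *)

Section PullbackClosed.
Context {R : realType} {d n : nat}.
Variables (P : 'rV[R]_d -> 'rV[R]_n) (B : 'rV[R]_n -> 'I_n -> R) (x : 'rV[R]_d).
Local Notation e i := (delta_mx 0 i).
Hypothesis P_diff : \forall y \near x, differentiable P y.
Hypothesis dP_diff : forall w, differentiable ('D_w P) x.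
Hypothesis B_diff : forall k, differentiable (B^~ k) (P x).
Hypothesis B_closed : forall j k, 'D_(e j) (B^~ k) (P x) = 'D_(e k) (B^~ j) (P x).

Let Px : differentiable P x := nbhs_singleton P_diff.

Lemma diff_row_sum (y w : 'rV[R]_d) k : differentiable P y ->
  ('d P y w) 0 k = \sum_i w 0 i * ('D_(e i) P y) 0 k.
Proof.
move=> dP; rewrite {1}[w]row_sum_delta linear_sum summxE; apply: eq_bigr => i _.
by rewrite linearZ mxE deriveE.
Qed.

Lemma second_derivative_sym i j k :
  'D_(e i) (fun y => ('D_(e j) P y) 0 k) x = 'D_(e j) (fun y => ('D_(e i) P y) 0 k) x.
Proof.
have E i' : {near x, (fun y => ('D_(e i') P y) 0 k) =1 'D_(e i') (fun y => P y 0 k)}.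
  by near=> y; rewrite derive_mx ?mxE //; apply: diff_derivable; near: y.
have Dc i' : differentiable (fun y => ('D_(e i') P y) 0 k) x.
  apply: (@differentiable_comp _ _ _ _ ('D_(e i') P) (fun r : 'rV[R]_n => r 0 k)) => //.
  exact: differentiable_coord.
transitivity ('D_(e i) ('D_(e j) (fun y => P y 0 k)) x).
  exact: near_eq_derive (E j).
transitivity ('D_(e j) ('D_(e i) (fun y => P y 0 k)) x); last first.
  by apply/esym; exact: near_eq_derive (E i).
apply: (@schwarz _ _ (fun y => P y 0 k) x (e j) (e i)).
- near=> y; have /derivable_mxP : derivable P y (e j); last exact.
  by apply: diff_derivable; near: y.
- near=> y; have /derivable_mxP : derivable P y (e i); last exact.
  by apply: diff_derivable; near: y.
- exact: (near_eq_differentiable (E j) (Dc j)).1.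
- exact: (near_eq_differentiable (E i) (Dc i)).1.
Unshelve. all: by end_near. Qed.

(** The part of the derivative of the pairing in which the field itself is not differentiated:
    derivatives of the form's coefficients, then second derivatives of [P]. Closedness makes the
    first sum symmetric, equality of mixed derivatives the second. *)
Let bil (u v : 'rV[R]_d) :=
  \sum_k \sum_j ('d P x u) 0 j * ('d P x v) 0 k * 'D_(e j) (B^~ k) (P x)
   + \sum_k B (P x) k * \sum_i \sum_j v 0 i * u 0 j * 'D_(e j) (fun y => ('D_(e i) P y) 0 k) x.

Lemma bil_sym u v : bil u v = bil v u.
Proof.
rewrite /bil; congr (_ + _).
  rewrite exchange_big; apply: eq_bigr => j _; apply: eq_bigr => k _.
  by rewrite B_closed mulrAC mulrC mulrA mulrAC.
apply: eq_bigr => k _; congr (_ * _).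
rewrite exchange_big; apply: eq_bigr => j _; apply: eq_bigr => i _.
by apply: (congr2 *%R); [exact: mulrC|exact: second_derivative_sym].
Qed.

Lemma derive_pairing (g : 'rV[R]_d -> 'rV[R]_d) u : differentiable g x ->
  'D_u (fun y => \sum_k B (P y) k * ('d P y (g y)) 0 k) x =
  bil u (g x) + \sum_k B (P x) k * ('d P x ('D_u g x)) 0 k.
Proof.
move=> dg.
have N : {near x, (fun y => \sum_k B (P y) k * ('d P y (g y)) 0 k) =1
   \sum_k (fun y => B (P y) k) * (\sum_i (fun y => g y 0 i) * (fun y => ('D_(e i) P y) 0 k))}.
  near=> y; rewrite fct_sumE; apply: eq_bigr => k _.
  rewrite diff_row_sum; last by near: y.
  by rewrite fctE; congr (_ * _); rewrite fct_sumE; apply: eq_bigr.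
rewrite (near_eq_derive _ N).
have hg i : is_derive x u (fun y => g y 0 i) (('D_u g x) 0 i).
  by apply: is_derive_coord; apply: derivableP; exact: diff_derivable.
have hD i k : is_derive x u (fun y => ('D_(e i) P y) 0 k)
    (\sum_j u 0 j * 'D_(e j) (fun y => ('D_(e i) P y) 0 k) x).
  have dD : differentiable (fun y => ('D_(e i) P y) 0 k) x.
    apply: (@differentiable_comp _ _ _ _ ('D_(e i) P) (fun r : 'rV[R]_n => r 0 k)) => //.
    exact: differentiable_coord.
  apply: DeriveDef; first exact: diff_derivable.
  rewrite deriveE // {1}[u]row_sum_delta linear_sum; apply: eq_bigr => j _.
  by rewrite linearZ_LR deriveE.
have hB k : is_derive x u (fun y => B (P y) k)
    (\sum_j ('d P x u) 0 j * 'D_(e j) (B^~ k) (P x)).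
  apply: DeriveDef.
    by apply: diff_derivable; exact: (@differentiable_comp _ _ _ _ P (B^~ k)).
  rewrite deriveE; last exact: (@differentiable_comp _ _ _ _ P (B^~ k)).
  rewrite (@diff_comp _ _ _ _ P (B^~ k)) //= {1}['d P x u]row_sum_delta linear_sum.
  by apply: eq_bigr => j _; rewrite linearZ_LR deriveE.
have h := is_derive_sum (fun k => is_deriveM (hB k)
  (is_derive_sum (fun i => is_deriveM (hg i) (hD i k)))).
rewrite (@derive_val _ _ _ _ _ _ _ h).
rewrite /bil -!big_split /=; apply: eq_bigr => k _.
rewrite !diff_row_sum // fct_sumE.
rewrite [LHS]addrC -[RHS]addrA -[X in _ = _ + X]mulrDr -big_split /=; congr (_ + _).
  rewrite /GRing.scale /= mulr_sumr; apply: eq_bigr => j _.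
  by rewrite mulrA [X in X * _]mulrC.
rewrite /GRing.scale /=; congr (_ * _); apply: eq_bigr => i _.
rewrite [X in _ + X]mulrC; congr (_ + _); rewrite mulr_sumr; apply: eq_bigr => j _.
by rewrite mulrA.
Unshelve. all: by end_near. Qed.

(** Cartan's formula for the exterior derivative in coordinates: both pairings are locally constant,
    so their derivatives along [f x] and [g x] vanish, and [bil_sym] cancels all but the bracket
    term. *)
Lemma pullback_closed (f g : 'rV[R]_d -> 'rV[R]_d) (cf cg : R) :
  differentiable f x -> differentiable g x ->
  (\forall y \near x, \sum_k B (P y) k * ('d P y (f y)) 0 k = cf) ->
  (\forall y \near x, \sum_k B (P y) k * ('d P y (g y)) 0 k = cg) ->
  \sum_k B (P x) k * ('d P x ('D_(f x) g x - 'D_(g x) f x)) 0 k = 0.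
Proof.
move=> df dg Nf Ng.
have := derive_pairing (f x) dg; rewrite (near_eq_derive (g := cst cg)) // derive_cst => /eqP.
rewrite eq_sym addr_eq0 bil_sym => /eqP E.
have := derive_pairing (g x) df; rewrite (near_eq_derive (g := cst cf)) // derive_cst => /eqP.
rewrite eq_sym addr_eq0 => /eqP E'.
transitivity (\sum_k B (P x) k * ('d P x ('D_(f x) g x)) 0 k -
  \sum_k B (P x) k * ('d P x ('D_(g x) f x)) 0 k).
  by rewrite -sumrB; apply: eq_bigr => k _; rewrite linearB -mulrBr !mxE.
by apply/eqP; rewrite subr_eq0 -eqr_opp -E -E' .
Qed.

End PullbackClosed.

(** * Charts, chain rule and changes of chart *)

Section ChartLemmas.
Context {R : realType} {T : topologicalType} {n : nat} (c : chart R T n).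

Lemma cimgP x : cimg c x -> cdom c (cinv c x) /\ cmap c (cinv c x) = x.
Proof. by case=> p pc <-; rewrite cmapK. Qed.

Lemma cimg_map p : cdom c p -> cimg c (cmap c p).
Proof. by move=> pc; exists p. Qed.

Lemma cimg_near p : cdom c p -> \forall x \near cmap c p, cimg c x.
Proof. by move=> pc; apply: open_nbhs_nbhs; split; [exact: cimg_open|exact: cimg_map]. Qed.

Lemma cinv_near (T' : topologicalType) (f : T -> T') (U : set T') p : cdom c p ->
  {for p, continuous f} -> open U -> U (f p) ->
  \forall x \near cmap c p, U (f (cinv c x)).
Proof.
move=> pc fc oU Ufp.
have ic : {for cmap c p, continuous (cinv c)} by apply: cinv_continuous; exact: cimg_map.
have fc' : {for cmap c p, continuous (f \o cinv c)}.
  by apply: continuous_comp => //; rewrite cmapK.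
by apply: fc'; apply: open_nbhs_nbhs; split => //=; rewrite cmapK.
Qed.

End ChartLemmas.

Section ChartChain.
Context {R : realType} {T1 T2 T3 : topologicalType} {n1 n2 n3 : nat}.
Variables (c1 : chart R T1 n1) (c2 : chart R T2 n2) (c3 : chart R T3 n3).

(** Continuity of [f] keeps nearby points inside the middle chart, where [cinv c2] undoes [cmap c2];
    the coordinate expression of the composite is then locally a composite of coordinate
    expressions. *)
Lemma chart_chain (f : T1 -> T2) (g : T2 -> T3) p :
  cdom c1 p -> cdom c2 (f p) -> {for p, continuous f} ->
  differentiable (cmap c2 \o f \o cinv c1) (cmap c1 p) ->
  differentiable (cmap c3 \o g \o cinv c2) (cmap c2 (f p)) ->
  differentiable (cmap c3 \o (g \o f) \o cinv c1) (cmap c1 p) /\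
  'd (cmap c3 \o (g \o f) \o cinv c1) (cmap c1 p) =
  'd (cmap c3 \o g \o cinv c2) (cmap c2 (f p)) \o
    'd (cmap c2 \o f \o cinv c1) (cmap c1 p) :> (_ -> _).
Proof.
move=> p1 p2 fc df dg.
have Ef : (cmap c2 \o f \o cinv c1) (cmap c1 p) = cmap c2 (f p) by rewrite /= cmapK.
have dg' : differentiable (cmap c3 \o g \o cinv c2) ((cmap c2 \o f \o cinv c1) (cmap c1 p)).
  by rewrite Ef.
have dgf := differentiable_comp df dg'.
have N : {near cmap c1 p, (cmap c3 \o g \o cinv c2) \o (cmap c2 \o f \o cinv c1) =1
   cmap c3 \o (g \o f) \o cinv c1}.
  have := cinv_near p1 fc (@cdom_open _ _ _ c2) p2.
  by apply: filterS => x xd /=; rewrite cmapK.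
have [H ->] := near_eq_differentiable N dgf; split=> //.
by rewrite (diff_comp df dg') Ef.
Qed.

End ChartChain.

Lemma smooth_on_differentiable (R : realType) (V W : normedModType R) (U : set V)
  (f : V -> W) x : smooth_on U f -> U x -> differentiable f x.
Proof. by move=> /(_ 1) [/(_ x) df _] /df. Qed.

Lemma smooth_on_derive (R : realType) (V W : normedModType R) (U : set V)
  (f : V -> W) v : smooth_on U f -> smooth_on U ('D_v f).
Proof. by move=> sf k; have [_ /(_ v)] := sf k.+1. Qed.

Section Charts.
Context {R : realType} {T : topologicalType} {n : nat} (S : smooth_structure R T n).

(** The [id] in the middle presents a change of chart as a map between manifolds, ready for
    [chart_chain]. *)
Lemma transition_differentiable c c' p : atlas S c -> atlas S c' -> cdom c p -> cdom c' p ->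
  differentiable (cmap c' \o id \o cinv c) (cmap c p).
Proof.
move=> ac ac' pc pc'; apply: (smooth_on_differentiable (atlas_compat ac ac')).
by exists p.
Qed.

Lemma chart_id_diff (c : chart R T n) p : cdom c p ->
  'd (cmap c \o id \o cinv c) (cmap c p) = id :> (_ -> _).
Proof.
move=> pc.
have N : {near cmap c p, id =1 cmap c \o id \o cinv c}.
  by have := cimg_near pc; apply: filterS => x /cimgP[_ /= ->].
have [_ ->] := near_eq_differentiable N (ex_diff (is_diff_def := is_diff_id (cmap c p))).
by rewrite diff_val.
Qed.

Lemma from_chartE c p : cdom c p ->
  from_chart S c (cmap c p) = 'd (cmap (chart_at S p) \o id \o cinv c) (cmap c p) :> (_ -> _).
Proof. by move=> pc; rewrite /from_chart cmapK. Qed.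

Lemma from_to_chart c p v : atlas S c -> cdom c p ->
  from_chart S c (cmap c p) (to_chart S c p v) = v.
Proof.
move=> ac pc; rewrite from_chartE //.
have [_ E] := @chart_chain _ _ _ _ _ _ _ (chart_at S p) c (chart_at S p) id id p
  (chart_at_dom S p) pc (fun _ h => h)
  (transition_differentiable (chart_at_atlas S p) ac (chart_at_dom S p) pc)
  (transition_differentiable ac (chart_at_atlas S p) pc (chart_at_dom S p)).
rewrite -[RHS](congr1 (fun h => h v) (chart_id_diff (chart_at_dom S p))).
exact: (congr1 (fun h => h v) (esym E)).
Qed.

Lemma to_from_chart c p v : atlas S c -> cdom c p ->
  to_chart S c p (from_chart S c (cmap c p) v) = v.
Proof.
move=> ac pc; rewrite from_chartE //.
have [_ E] := @chart_chain _ _ _ _ _ _ _ c (chart_at S p) c id id p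
  pc (chart_at_dom S p) (fun _ h => h)
  (transition_differentiable ac (chart_at_atlas S p) pc (chart_at_dom S p))
  (transition_differentiable (chart_at_atlas S p) ac (chart_at_dom S p) pc).
rewrite -[RHS](congr1 (fun h => h v) (chart_id_diff pc)).
exact: (congr1 (fun h => h v) (esym E)).
Qed.

End Charts.

Section SmoothMaps.
Context {R : realType} {T1 T2 : topologicalType} {n1 n2 : nat}.
Variables (S1 : smooth_structure R T1 n1) (S2 : smooth_structure R T2 n2).

Lemma smooth_map_differentiable f c1 c2 p : smooth_map S1 S2 f ->
  atlas S1 c1 -> atlas S2 c2 -> cdom c1 p -> cdom c2 (f p) ->
  differentiable (cmap c2 \o f \o cinv c1) (cmap c1 p).
Proof.
move=> [_ sf] a1 a2 p1 p2; apply: (smooth_on_differentiable (sf _ _ a1 a2)).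
by exists p.
Qed.

End SmoothMaps.

(** * Brackets of left-invariant fields *)

Section RowMx.
Context {R : realType} {n1 n2 : nat}.

Lemma row_mx0_is_linear : linear (fun y : 'rV[R]_n2 => row_mx (0 : 'rV[R]_n1) y).
Proof. by move=> k u v; rewrite scale_row_mx add_row_mx scaler0 addr0. Qed.

Lemma row_0mx_is_linear : linear (fun y : 'rV[R]_n1 => row_mx y (0 : 'rV[R]_n2)).
Proof. by move=> k u v; rewrite scale_row_mx add_row_mx scaler0 addr0. Qed.

Lemma differentiable_row_mxr (z : 'rV[R]_n1) (y : 'rV[R]_n2) :
  differentiable (fun y => row_mx z y) y.
Proof.
pose L : {linear 'rV[R]_n2 -> 'rV[R]_(n1 + n2)} :=
  HB.pack (fun y : 'rV[R]_n2 => row_mx (0 : 'rV[R]_n1) y)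
    (GRing.isLinear.Build _ _ _ _ _ row_mx0_is_linear).
have -> : (fun y => row_mx z y) = cst (row_mx z 0) + (L : _ -> _).
  by apply/funext => w; rewrite fctE /= add_row_mx addr0 add0r.
apply: differentiableD; first exact: differentiable_cst.
exact: linear_rV_differentiable.
Qed.

Lemma differentiable_row_mxl (z : 'rV[R]_n2) (y : 'rV[R]_n1) :
  differentiable (fun y => row_mx y z) y.
Proof.
pose L : {linear 'rV[R]_n1 -> 'rV[R]_(n1 + n2)} :=
  HB.pack (fun y : 'rV[R]_n1 => row_mx y (0 : 'rV[R]_n2))
    (GRing.isLinear.Build _ _ _ _ _ row_0mx_is_linear).
have -> : (fun y => row_mx y z) = cst (row_mx 0 z) + (L : _ -> _).
  by apply/funext => w; rewrite fctE /= add_row_mx addr0 add0r.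
apply: differentiableD; first exact: differentiable_cst.
exact: linear_rV_differentiable.
Qed.

Lemma derive_row_mxr (W : normedModType R) (f : 'rV[R]_(n1 + n2) -> W) z y v :
  'D_(row_mx 0 v) f (row_mx z y) = 'D_v (fun y => f (row_mx z y)) y.
Proof.
rewrite /derive; under eq_fun do rewrite /= scale_row_mx scaler0 add_row_mx add0r.
by [].
Qed.

End RowMx.

Section LieGroup.
Context {R : realType} {G : topGroupType} {d : nat} (S : smooth_structure R G d).
Hypothesis hG : lie_group S.
Local Notation c := (chart_at S 1%g).
Local Notation x0 := (cmap c 1%g).

Lemma lie_group_smooth2 c1 c2 c3 (g h : G) : atlas S c1 -> atlas S c2 -> atlas S c3 ->
  cdom c1 g -> cdom c2 h -> cdom c3 (g * h)%g ->
  exists2 U, smooth_on U (fun w : 'rV[R]_(d + d) =>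
         cmap c3 (cinv c1 (lsubmx w) * cinv c2 (rsubmx w))%g) &
   U (row_mx (cmap c1 g) (cmap c2 h)).
Proof.
move=> a1 a2 a3 g1 h2 gh3; have [[_ /(_ c1 c2 c3 a1 a2 a3) s] _] := hG.
by eexists; [exact: s|exists (g, h)].
Qed.

Lemma lmul_continuous (g : G) : continuous (fun h : G => (g * h)%g).
Proof.
move=> h; have [[mc _] _] := hG.
apply: (@continuous_comp _ _ _ (fun h : G => (g, h)) (fun p : G * G => (p.1 * p.2)%g)).
  by apply: cvg_pair => //=; exact: cvg_cst.
exact: mc.
Qed.

Lemma lmul_differentiable c1 c2 (g p : G) : atlas S c1 -> atlas S c2 ->
  cdom c1 p -> cdom c2 (g * p)%g ->
  differentiable (cmap c2 \o (fun h : G => (g * h)%g) \o cinv c1) (cmap c1 p).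
Proof.
move=> a1 a2 p1 gp2.
have [U sU Up] := lie_group_smooth2 (chart_at_atlas S g) a1 a2 (chart_at_dom S g) p1 gp2.
have dU := smooth_on_differentiable sU Up.
have := differentiable_comp (differentiable_row_mxr (cmap (chart_at S g) g) (cmap c1 p)) dU.
congr (differentiable _ _); apply/funext => y /=.
by rewrite row_mxKl row_mxKr cmapK //; exact: chart_at_dom.
Qed.

Definition chart_mul (w : 'rV[R]_(d + d)) : 'rV[R]_d :=
  cmap c (cinv c (lsubmx w) * cinv c (rsubmx w))%g.

(** The left-invariant field in the fixed chart at 1, as a partial derivative of multiplication.
    [left_field] refers to a preferred chart that varies with the point; here smoothness in [x] is
    visible, since [chart_mul] is one smooth function. *)
Definition left_vec (v x : 'rV[R]_d) := 'D_(row_mx 0 v) chart_mul (row_mx x x0).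

Let c1 : cdom c 1%g := chart_at_dom S 1%g.
Let ac : atlas S c := chart_at_atlas S 1%g.

Lemma left_vecE v g : cdom c g ->
  left_vec v (cmap c g) = 'd (cmap c \o (fun h : G => (g * h)%g) \o cinv c) x0 v.
Proof.
move=> gc; rewrite /left_vec derive_row_mxr.
have -> : (fun y => chart_mul (row_mx (cmap c g) y)) =
    cmap c \o (fun h : G => (g * h)%g) \o cinv c.
  by apply/funext => y; rewrite /chart_mul row_mxKl row_mxKr /= cmapK.
by apply: deriveE; apply: lmul_differentiable => //; rewrite mulg1.
Qed.

Lemma field_in_left_field v g : cdom c g ->
  field_in S c (left_field S v) (cmap c g) = left_vec v (cmap c g).
Proof.
move=> gc; rewrite left_vecE // /field_in cmapK //.
have gg : cdom (chart_at S g) (g * 1)%g by rewrite mulg1; exact: chart_at_dom.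
have gc' : cdom c (g * 1)%g by rewrite mulg1.
have [_ E] := @chart_chain _ _ _ _ _ _ _ c (chart_at S g) c (fun h : G => (g * h)%g) id 1%g
  c1 gg (@lmul_continuous g 1%g)
  (lmul_differentiable ac (chart_at_atlas S g) c1 gg)
  (transition_differentiable (chart_at_atlas S g) ac gg gc').
have := congr1 (fun h => h v) E.
by rewrite /left_field /to_chart /mdiff mulg1 => /esym.
Qed.

Lemma chart_mul_differentiable g w : cdom c g ->
  differentiable chart_mul (row_mx (cmap c g) x0) /\
  differentiable ('D_w chart_mul) (row_mx (cmap c g) x0).
Proof.
move=> gc; have gc' : cdom c (g * 1)%g by rewrite mulg1.
have [U sU Up] := lie_group_smooth2 ac ac ac gc c1 gc'.
split; first exact: (smooth_on_differentiable sU).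
exact: (smooth_on_differentiable (smooth_on_derive w sU)).
Qed.

Lemma left_vec_differentiable v : differentiable (left_vec v) x0.
Proof.
have [_ dD] := chart_mul_differentiable (row_mx 0 v) c1.
exact: (differentiable_comp (differentiable_row_mxl x0 x0) dD).
Qed.

Lemma mul1g_id : (fun h : G => (1 * h)%g) = id.
Proof. by apply/funext => h; rewrite mul1g. Qed.

Lemma left_vec1 v : left_vec v x0 = v.
Proof. by rewrite left_vecE // mul1g_id chart_id_diff. Qed.

Lemma left_field1 v : left_field S v 1%g = v.
Proof. by rewrite /left_field mul1g_id /mdiff chart_id_diff. Qed.

(** Stated only near [x0], because linearity in the vector comes from differentiability of
    [chart_mul], known over the chart domain. *)
Lemma left_vec_linear k u v :
  {near x0, k *: left_vec u + left_vec v =1 left_vec (k *: u + v)}.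
Proof.
apply: filterS (cimg_near c1) => x /cimgP[gc <-].
have [D _] := chart_mul_differentiable 0 gc.
rewrite /left_vec [RHS](deriveE _ D).
have -> : row_mx 0 (k *: u + v) = k *: row_mx 0 u + row_mx 0 v :> 'rV[R]_(d + d).
  by rewrite scale_row_mx add_row_mx scaler0 addr0.
by rewrite linearP -(deriveE (row_mx 0 u) D) -(deriveE (row_mx 0 v) D).
Qed.

Lemma lie_bracketE u v :
  lie_bracket S u v = 'D_u (left_vec v) x0 - 'D_v (left_vec u) x0.
Proof.
rewrite /lie_bracket /field_bracket !left_field1.
have N w : {near x0, field_in S c (left_field S w) =1 left_vec w}.
  apply: filterS (cimg_near c1) => x /cimgP[gc <-]; exact: field_in_left_field.
by rewrite (near_eq_derive _ (N u)) (near_eq_derive _ (N v)).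
Qed.

Lemma lie_bracket_linear z : linear (lie_bracket S z).
Proof.
move=> k u v.
have dv w := left_vec_differentiable w.
have D1 w : is_derive x0 z (left_vec w) ('D_z (left_vec w) x0).
  by apply: derivableP; exact: diff_derivable.
have h := near_eq_is_derive (left_vec_linear k u v) (is_deriveD (is_deriveZ k (D1 u)) (D1 v)).
have E1 : 'D_z (left_vec (k *: u + v)) x0 = k *: 'D_z (left_vec u) x0 + 'D_z (left_vec v) x0.
  exact: (@derive_val _ _ _ _ _ _ _ h).
have E2 : 'D_(k *: u + v) (left_vec z) x0 = k *: 'D_u (left_vec z) x0 + 'D_v (left_vec z) x0.
  by rewrite (deriveE (k *: u + v) (dv z)) (deriveE u (dv z)) (deriveE v (dv z)) linearP.
have alg (A B C D : 'rV[R]_d) : k *: A + B - (k *: C + D) = k *: (A - C) + (B - D).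
  by rewrite scalerBr opprD -!addrA; congr (_ + _); rewrite addrCA.
apply: etrans (lie_bracketE z (k *: u + v)) _.
apply: etrans (congr2 (fun s t => s - t) E1 E2) _.
apply: etrans (alg _ _ _ _) _; apply/esym.
exact: (congr2 (fun s t => k *: s + t) (lie_bracketE z u) (lie_bracketE z v)).
Qed.

End LieGroup.

(** * The homogeneous space *)

Section Gram.
Context {R : realType} {T : topologicalType} {n : nat} (S : smooth_structure R T n).
Variables (a : T -> 'M[R]_n) (X : T -> 'rV[R]_n) (m : R) (c : chart R T n).
Hypothesis ac : atlas S c.
Local Notation e i := (delta_mx 0 i : 'rV[R]_n).

Definition gram (x : 'rV[R]_n) : 'M[R]_n :=
  \matrix_(i, j) inner (a (cinv c x)) (from_chart S c x (e i)) (from_chart S c x (e j)).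

Lemma inner_gram x u v :
  inner (gram x) u v = inner (a (cinv c x)) (from_chart S c x u) (from_chart S c x v).
Proof.
rewrite innerE -(bilinear_row_sum
  (f := fun u v => inner (a (cinv c x)) (from_chart S c x u) (from_chart S c x v))).
- by apply: eq_bigr => i _; apply: eq_bigr => j _; rewrite mxE mulrAC.
- by move=> w k s t; rewrite /from_chart linearP innerDl innerZl.
- by move=> w k s t; rewrite /from_chart linearP innerDr innerZr.
Qed.

Lemma inner_gram_field x v : cimg c x ->
  inner (gram x) (field_in S c X x) v =
  inner (a (cinv c x)) (X (cinv c x)) (from_chart S c x v).
Proof.
move=> /cimgP[pc xE]; rewrite inner_gram; congr (inner _ _ _).
by rewrite -{1}xE /field_in from_to_chart.
Qed.

(** In coordinates the metric is again an m-Kropina metric, built from the Gram matrix and the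
    components of the field; this brings the manifold into the setting of the local Berwald
    computation. *)
Lemma metric_in_kropina x : cimg c x ->
  metric_in S (kropina a X m) c x = kropina gram (field_in S c X) m x.
Proof.
by move=> xc; apply/funext => y; rewrite /metric_in /kropina inner_gram inner_gram_field.
Qed.

Lemma dom_in_kropina x y : cimg c x ->
  dom_in S (kropina_dom a X) c x y = kropina_dom gram (field_in S c X) x y.
Proof. by move=> xc; rewrite /dom_in /kropina_dom /= inner_gram_field. Qed.

Hypothesis ha : riemannian_metric S a.

Lemma gram_sym x : (gram x)^T = gram x.
Proof.
by have [sa _ _] := ha; apply/matrixP => i j; rewrite !mxE inner_sym.
Qed.

Lemma gram_pos x v : cimg c x -> v != 0 -> 0 < inner (gram x) v v.
Proof.
move=> /cimgP[pc xE] v0; rewrite inner_gram; have [_ pa _] := ha; apply: pa.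
apply: contra_neq v0 => fv.
(* [from_chart] is injective here, [to_chart] being its left inverse. *)
rewrite -(to_from_chart v ac pc) xE fv /to_chart; exact: linear0.
Qed.

Lemma gram_differentiable x i j : cimg c x -> differentiable (fun z => gram z i j) x.
Proof.
move=> xc; have [_ _ /(_ c i j ac) s] := ha.
have -> : (fun z => gram z i j) = fun z => inner (a (cinv c z))
           (from_chart S c z (e i)) (from_chart S c z (e j)).
  by apply/funext => z; rewrite mxE.
exact: (smooth_on_differentiable s xc).
Qed.

End Gram.

Section Coset.
Context {R : realType} {G : topGroupType} {d n : nat} {H : closed_subgroup G}.
Variables (SG : smooth_structure R G d) (SM : smooth_structure R (coset_space H) n).
Hypothesis hG : lie_group SG.
Hypothesis hSM : submersion SG SM (@coset_proj G H).
Local Notation proj := (@coset_proj G H).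
Local Notation p0 := (base_point H).

Lemma coset_proj_eq (x y : G) : subgroup_set H (x^-1 * y)%g -> proj x = proj y.
Proof. by move=> h; apply/eqquotP; apply/asboolP. Qed.

Lemma coset_proj_repr (p : coset_space H) : proj (repr p) = p.
Proof. exact: reprK. Qed.

Lemma coset_repr_proj (x : G) : subgroup_set H ((repr (proj x))^-1 * x)%g.
Proof. by have /eqquotP/asboolP := coset_proj_repr (proj x). Qed.

Lemma coset_act_proj (g x : G) : coset_act g (proj x) = proj (g * x)%g.
Proof.
apply: coset_proj_eq; rewrite invgM -mulgA mulKg; exact: coset_repr_proj.
Qed.

Lemma coset_act_proj_comp (g : G) : coset_act g \o proj = proj \o (fun h => g * h)%g.
Proof. by apply/funext => x; exact: coset_act_proj. Qed.

Lemma coset_act_base (g : G) : coset_act g p0 = proj g.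
Proof. by rewrite coset_act_proj mulg1. Qed.

Lemma coset_proj_continuous : continuous proj.
Proof. by have [[]] := hSM. Qed.

Lemma coset_act_continuous (g : G) : continuous (coset_act g : coset_space H -> coset_space H).
Proof.
have ct : continuous (coset_act g \o proj).
  rewrite coset_act_proj_comp => x; apply: continuous_comp; first exact: (lmul_continuous hG).
  exact: coset_proj_continuous.
(* By the quotient topology, openness of a preimage is tested after pulling back along [proj]. *)
by apply/continuousP => A oA; move/continuousP: ct => /(_ A oA).
Qed.

Lemma coset_proj_differentiable cG cM g : atlas SG cG -> atlas SM cM ->
  cdom cG g -> cdom cM (proj g) ->
  differentiable (cmap cM \o proj \o cinv cG) (cmap cG g).
Proof. by have [sm _] := hSM; exact: smooth_map_differentiable. Qed.

(** The one-parameter subgroup stays in H, so its projection is constant, and the chain rule at 0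
    computes the derivative of that constant curve. *)
Lemma tangent_proj_lie_subalgebra v : lie_subalgebra SG H v -> tangent_proj SG SM v = 0.
Proof.
case=> gam [gc gD gv] gH.
have g0 : gam 0 = 1%g.
  have := gD 0 0; rewrite addr0 => /(congr1 (fun x => (gam 0)^-1 * x)%g).
  by rewrite mulVg mulKg.
pose cG := chart_at SG 1%g; pose cM := chart_at SM p0.
have c1 : cdom cG (gam 0) by rewrite g0; exact: chart_at_dom.
have [dg <-] := gv; rewrite /tangent_proj /mdiff.
have dgam : differentiable (cmap cG \o gam) (0 : R) by apply/derivable1_diffP.
have dP : differentiable (cmap cM \o proj \o cinv cG) ((cmap cG \o gam) 0).
  rewrite /= g0; apply: coset_proj_differentiable => //; try exact: chart_at_atlas.
    exact: chart_at_dom.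
  exact: chart_at_dom.
rewrite (deriveE _ dgam).
have := congr1 (fun h => h 1) (diff_comp dgam dP); rewrite /= g0 => <-.
have N : {near (0 : R), cst (cmap cM p0) =1 (cmap cM \o proj \o cinv cG) \o (cmap cG \o gam)}.
  have : \forall t \near (0 : R), cdom cG (gam t).
    by apply: (gc 0); apply: open_nbhs_nbhs; split => //; exact: cdom_open.
  apply: filterS => t tc /=; rewrite cmapK //; congr (cmap _ _).
  by apply: coset_proj_eq; rewrite invg1 mul1g.
have [_ ->] := near_eq_differentiable N (differentiable_cst _ _).
by rewrite diff_cst.
Qed.

End Coset.

(** * The invariant 1-form beta and its pullback to the group *)

Section InvariantForm.
Context {R : realType} {G : topGroupType} {d n : nat} {H : closed_subgroup G}.
Variables (SG : smooth_structure R G d) (SM : smooth_structure R (coset_space H) n).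
Hypothesis hG : lie_group SG.
Hypothesis hSM : submersion SG SM (@coset_proj G H).
Variables (a : coset_space H -> 'M[R]_n) (X : coset_space H -> 'rV[R]_n).
Hypothesis ha : riemannian_metric SM a.
Hypothesis ha_inv : invariant_metric SM a.
Hypothesis hX : smooth_field SM X.
Hypothesis hX_inv : invariant_field SM X.
Hypothesis hX0 : X (base_point H) != 0.
Local Notation proj := (@coset_proj G H).
Local Notation p0 := (base_point H).
Local Notation act g := (@coset_act G H g).
Local Notation c := (chart_at SG 1%g).
Local Notation x0 := (cmap c 1%g).
Local Notation cM := (chart_at SM p0).
Local Notation z0 := (cmap cM p0).

Let c1 : cdom c 1%g := chart_at_dom SG 1%g.
Let ac : atlas SG c := chart_at_atlas SG 1%g.
Let cM0 : cdom cM p0 := chart_at_dom SM p0.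
Let aM : atlas SM cM := chart_at_atlas SM p0.

(* An isometry has nonzero differential, whereas ['d] is 0 where a map is not
   differentiable; this spares constructing local sections of [coset_proj]. *)
Lemma coset_act_differentiable_at g (p : coset_space H) :
  differentiable (cmap (chart_at SM (act g p)) \o act g \o cinv (chart_at SM p))
    (cmap (chart_at SM p) p).
Proof.
apply: (@diff_neq0_differentiable _ _ _ _ _ (X p0)).
apply/negP => /eqP E; have := ha_inv g p (X p0) (X p0).
rewrite /mdiff E linear0 => /esym/eqP; have [_ pa _] := ha.
by rewrite gt_eqF // pa.
Qed.

Let act_ct g : {for p0, continuous (act g)}.
Proof. exact: (coset_act_continuous hG hSM). Qed.

Lemma coset_act_differentiable g : cdom cM (act g p0) ->
  differentiable (cmap cM \o act g \o cinv cM) z0.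
Proof.
move=> gM.
have [D _] := @chart_chain _ _ _ _ _ _ _ cM (chart_at SM (act g p0)) cM (act g) id p0
  cM0 (chart_at_dom SM _) (@act_ct g)
  (coset_act_differentiable_at g p0)
  (transition_differentiable (chart_at_atlas SM _) aM (chart_at_dom SM _) gM).
exact: D.
Qed.

(** The pullback of beta is left-invariant: [proj] intertwines left multiplication by [g] with
    [act g], which preserves both the metric and the field. Hence the value on a left-invariant
    field does not depend on [g]. *)
Lemma invariant_form_chart v g : cdom c g -> cdom cM (proj g) ->
  inner (gram SM a cM (cmap cM (proj g))) (field_in SM cM X (cmap cM (proj g)))
    ('d (cmap cM \o proj \o cinv c) (cmap c g) (left_vec SG v (cmap c g))) =
  inner (a p0) (X p0) (tangent_proj SG SM v).
Proof.
move=> gc gM; rewrite (left_vecE hG) //.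
have gc' : cdom c (g * 1)%g by rewrite mulg1.
have dP h : cdom c h -> cdom cM (proj h) ->
    differentiable (cmap cM \o proj \o cinv c) (cmap c h).
  by move=> hc hM; exact: (coset_proj_differentiable hSM).
have ctl : {for 1%g, continuous (fun h : G => (g * h)%g)} by exact: (lmul_continuous hG).
have ctp : {for 1%g, continuous proj} by exact: (coset_proj_continuous hSM).
have gM' : cdom cM (proj (g * 1)%g) by rewrite mulg1.
(* [E1] and [E2] differentiate the two factorizations of the same map, [proj] after left
   multiplication and [act g] after [proj]; [E3] passes to the preferred chart at [act g p0], in
   which invariance is stated. *)
have [_ E1] := @chart_chain _ _ _ _ _ _ _ c c cM (fun h : G => (g * h)%g) proj 1%g
  c1 gc' ctl (lmul_differentiable hG ac ac c1 gc') (dP _ gc' gM').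
have gM0 : cdom cM (act g p0) by rewrite coset_act_base.
have [_ E2] := @chart_chain _ _ _ _ _ _ _ c cM cM proj (act g) 1%g
  c1 cM0 ctp (dP _ c1 cM0) (coset_act_differentiable gM0).
have [_ E3] := @chart_chain _ _ _ _ _ _ _ cM cM (chart_at SM (act g p0)) (act g) id p0
  cM0 gM0 (@act_ct g) (coset_act_differentiable gM0)
  (transition_differentiable aM (chart_at_atlas SM _) gM0 (chart_at_dom SM _)).
have F1 : 'd (cmap cM \o proj \o cinv c) (cmap c g)
    ('d (cmap c \o (fun h : G => (g * h)%g) \o cinv c) x0 v) =
    'd (cmap cM \o (proj \o (fun h : G => (g * h)%g)) \o cinv c) x0 v.
  by have := congr1 (fun h => h v) E1; rewrite mulg1 => /esym.
have F2 : 'd (cmap cM \o (proj \o (fun h : G => (g * h)%g)) \o cinv c) x0 v =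
    'd (cmap cM \o act g \o cinv cM) z0 (tangent_proj SG SM v).
  by rewrite -coset_act_proj_comp; exact: (congr1 (fun h => h v) E2).
have F3 : from_chart SM cM (cmap cM (act g p0))
    ('d (cmap cM \o act g \o cinv cM) z0 (tangent_proj SG SM v)) =
    mdiff SM SM (act g) p0 (tangent_proj SG SM v).
  rewrite (from_chartE _ gM0).
  exact: (esym (congr1 (fun h => h (tangent_proj SG SM v)) E3)).
rewrite F1 F2 -coset_act_base inner_gram_field //; last exact: cimg_map.
by rewrite F3 cmapK // hX_inv ha_inv.
Qed.

Lemma inner_gram_base w :
  inner (gram SM a cM z0) (field_in SM cM X z0) w = inner (a p0) (X p0) w.
Proof.
rewrite inner_gram_field //; last exact: cimg_map.
by rewrite from_chartE // cmapK // chart_id_diff.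
Qed.

Local Notation P := (cmap cM \o proj \o cinv c).
Local Notation e i := (delta_mx 0 i : 'rV[R]_n).
Local Notation B := (fun z k => inner (gram SM a cM z) (field_in SM cM X z) (e k)).

Lemma proj_chart_differentiable g w : cdom c g -> cdom cM (proj g) ->
  differentiable P (cmap c g) /\ differentiable ('D_w P) (cmap c g).
Proof.
move=> gc gM; have [[_ /(_ c cM ac aM) s] _] := hSM.
have gU : (cmap c @` [set p | cdom c p /\ cdom cM (proj p)]) (cmap c g) by exists g.
split; first exact: smooth_on_differentiable s gU.
exact: smooth_on_differentiable (smooth_on_derive w s) gU.
Qed.

Lemma chart_near_base : \forall x \near x0,
  exists g, [/\ cmap c g = x, cdom c g & cdom cM (proj g)].
Proof.
have ctp : {for 1%g, continuous proj} by exact: (coset_proj_continuous hSM).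
have N := cinv_near c1 ctp (@cdom_open _ _ _ cM) cM0.
apply: filterS2 N (cimg_near c1) => x xM /cimgP[xc xE].
by exists (cinv c x).
Qed.

Lemma field_in_differentiable z : cimg cM z -> differentiable (field_in SM cM X) z.
Proof. exact: smooth_on_differentiable (hX aM). Qed.

Lemma invariant_form_bracket u v :
  (forall j k, 'D_(e j) (B^~ k) z0 = 'D_(e k) (B^~ j) z0) ->
  inner (a p0) (X p0) (tangent_proj SG SM (lie_bracket SG u v)) = 0.
Proof.
move=> closed.
have Px0 : P x0 = z0 by rewrite /= cmapK.
have z0i : cimg cM z0 by exact: cimg_map.
have Nc w : \forall y \near x0, \sum_k B (P y) k * ('d P y (left_vec SG w y)) 0 k =
    inner (a p0) (X p0) (tangent_proj SG SM w).
  apply: filterS chart_near_base => x [g [<- gc gM]].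
  rewrite -(invariant_form_chart w gc gM) /= cmapK //.
  set W := 'd _ _ _; rewrite -(linear_row_sum W (inner_is_linear _ _)).
  by apply: eq_bigr => k _; rewrite mulrC.
rewrite (lie_bracketE hG) -inner_gram_base.
have := @pullback_closed R d n P B x0 _ _ _ _
  (left_vec SG u) (left_vec SG v) _ _ _ _ (Nc u) (Nc v).
rewrite Px0 !(left_vec1 hG) => <- //.
- rewrite -(linear_row_sum _ (inner_is_linear _ _)).
  by apply: eq_bigr => k _; rewrite mulrC.
- apply: filterS chart_near_base => x [g [<- gc gM]].
  by case: (proj_chart_differentiable 0 gc gM).
- by move=> w; case: (proj_chart_differentiable w c1 cM0).
- move=> k; apply: differentiable_inner.
  + by move=> i j; exact: gram_differentiable.
  + exact: field_in_differentiable.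
  + exact: differentiable_cst.
- exact: left_vec_differentiable.
- exact: left_vec_differentiable.
Qed.

(** The action is transitive and preserves metric and field. This supplies the constant norm
    required in [berwald_parallel]. *)
Lemma invariant_norm (p : coset_space H) :
  inner (a p) (X p) (X p) = inner (a p0) (X p0) (X p0).
Proof.
by rewrite -(coset_proj_repr p) -coset_act_base hX_inv ha_inv.
Qed.

Variable m : R.
Hypothesis hm0 : m != 0.
Hypothesis hm1 : m != -1.
Hypothesis hF : finsler_metric SM (kropina_dom a X) (kropina a X m).
Hypothesis hF_berwald : berwald_type SM (kropina_dom a X) (kropina a X m).

Lemma metric_in_base : metric_in SM (kropina a X m) cM z0 = kropina a X m p0.
Proof.
apply/funext => y; rewrite /metric_in (from_chartE SM cM0) (cmapK cM0).
by rewrite (chart_id_diff cM0).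
Qed.

Lemma berwald_form_closed j k : 'D_(e j) (B^~ k) z0 = 'D_(e k) (B^~ j) z0.
Proof.
have z0i : cimg cM z0 by exact: cimg_map.
have [_ pa _] := ha.
have N := cimg_near cM0.
have FE : \forall z \near z0, metric_in SM (kropina a X m) cM z =
    kropina (gram SM a cM) (field_in SM cM X) m z.
  by apply: filterS N => z zi; exact: metric_in_kropina.
have a_sym : \forall z \near z0, (gram SM a cM z)^T = gram SM a cM z.
  by apply: filterE => z; exact: gram_sym.
have a_pos : \forall z \near z0, forall v, v != 0 -> 0 < inner (gram SM a cM z) v v.
  by apply: filterS N => z zi v; exact: gram_pos.
have X_norm : \forall z \near z0, inner (gram SM a cM z) (field_in SM cM X z)
    (field_in SM cM X z) = inner (a p0) (X p0) (X p0).
  apply: filterS N => z zi; rewrite inner_gram_field //.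
  case: (cimgP zi) => zc zE; rewrite -[X in from_chart _ _ X]zE /field_in.
  by rewrite zE -[X in from_chart _ _ X]zE from_to_chart // invariant_norm.
apply: (berwald_closed FE a_sym a_pos _ _ (pa _ _ hX0) X_norm _ hm0 _ _).
- by move=> i l; exact: gram_differentiable.
- exact: field_in_differentiable.
- move=> y u yD u0; rewrite metric_in_base; have [_ _ F_pos] := hF; apply: F_pos => //.
  by move: yD; rewrite /kropina_dom /= inner_gram_base.
- by rewrite -[1]opprK subr_eq0.
- move=> y y' yD yD' i l k'; apply: hF_berwald => //; by rewrite dom_in_kropina.
Qed.

End InvariantForm.

(** * Natural reductivity *)

Section ReductiveDecomposition.
Context {R : realType} {G : topGroupType} {d n : nat} {H : closed_subgroup G}.
Variables (SG : smooth_structure R G d) (SM : smooth_structure R (coset_space H) n).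
Hypothesis hG : lie_group SG.
Hypothesis hSM : submersion SG SM (@coset_proj G H).
Variables h q : {vspace 'rV[R]_d}.
Hypothesis hq : reductive_decomposition SG H h q.
Local Notation tp := (tangent_proj SG SM).

Lemma tangent_proj_is_linear : linear (tp : 'rV[R]_d -> 'rV[R]_n).
Proof. by move=> k u v; rewrite /tangent_proj /mdiff linearP. Qed.

Lemma tangent_proj_h v : v \in h -> tp v = 0.
Proof. by have [hh _ _ _] := hq; move=> /hh; exact: tangent_proj_lie_subalgebra. Qed.

(** The discarded h-component is killed by the differential of the projection, so [z, u] and its
    projection to [q] have the same image at the base point. *)
Lemma tangent_proj_daddv_pi v : tp (daddv_pi q h v) = tp v.
Proof.
have [_ full dir _] := hq.
have cap : (q :&: h = 0)%VS by rewrite capvC; exact/directv_addP.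
have E : daddv_pi q h v + daddv_pi h q v = v.
  by apply: daddv_pi_add => //; rewrite addvC full memvf.
rewrite -{2}E -[daddv_pi q h v]scale1r tangent_proj_is_linear !scale1r.
by rewrite (tangent_proj_h (memv_pi _ _ _)) addr0.
Qed.

Lemma tangent_proj_bracket_proj z u :
  tp (bracket_proj SG h q z u) = tp (lie_bracket SG z u).
Proof. exact: tangent_proj_daddv_pi. Qed.

Lemma bracket_proj_is_linear z : linear (bracket_proj SG h q z).
Proof. by move=> k u v; rewrite /bracket_proj (lie_bracket_linear hG) linearP. Qed.

Lemma tangent_proj_lift w : exists2 v, v \in q & tp v = w.
Proof.
have [_ /(_ 1%g w)[v vw]] := hSM.
by exists (daddv_pi q h v); [exact: memv_pi|rewrite tangent_proj_daddv_pi].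
Qed.

End ReductiveDecomposition.

Section Equivalence.
Context {R : realType} {G : topGroupType} {d n : nat} {H : closed_subgroup G}.
Variables (SG : smooth_structure R G d) (SM : smooth_structure R (coset_space H) n).
Hypothesis hG : lie_group SG.
Hypothesis hSM : submersion SG SM (@coset_proj G H).
Variables (a : coset_space H -> 'M[R]_n) (X : coset_space H -> 'rV[R]_n) (m : R).
Hypothesis ha : riemannian_metric SM a.
Hypothesis hX0 : X (base_point H) != 0.
Hypothesis hm0 : m != 0.
Hypothesis hm1 : m != -1.
Local Notation tp := (tangent_proj SG SM).
Local Notation p0 := (base_point H).
Local Notation ip := (inner (a p0)).
Local Notation b := (inner (a p0) (X p0)).
Local Notation K := (kropina a X m p0).

Let a_sym : (a p0)^T = a p0. Proof. by have [] := ha. Qed.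
Let a_pos v : v != 0 -> 0 < ip v v. Proof. by have [_ pa _] := ha; exact: pa. Qed.

Lemma fundamental_tensor_tangent_proj y u v :
  fundamental_tensor (fun w => K (tp w)) y u v = fundamental_tensor K (tp y) (tp u) (tp v).
Proof. exact: fundamental_tensor_comp. Qed.

Lemma cartan_tensor_tangent_proj y z u v :
  cartan_tensor (fun w => K (tp w)) y z u v = cartan_tensor K (tp y) (tp z) (tp u) (tp v).
Proof. exact: cartan_tensor_comp. Qed.

(** The left-hand side is the Finsler expression at u = v = y: its Cartan term vanishes, and each
    fundamental tensor is half the differential of F^2. *)
Lemma kropina_dlog_euler y w : kropina_dom a X p0 y ->
  fundamental_tensor K y w y + fundamental_tensor K y w y +
  2 * cartan_tensor K y w y y = K y ^+ 2 * dlog_kropina a X m p0 y w.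
Proof.
move=> yD; rewrite (cartan_tensor_kropina_eulerr m a_sym a_pos w yD).
rewrite (fundamental_tensor_kropina_sym m a_sym a_pos w y yD).
rewrite (fundamental_tensor_kropina_euler m a_sym a_pos w yD).
by field.
Qed.

(** Used with [z, .]_m as [D] and a lift of X as [X0]. Skewness is equivalent to <D y, y> = 0 on
    [q]; [cubic_identity] yields it on the lifted line and its beta-kernel complement, mixed terms
    included. *)
Lemma skew_of_kropina_identity (q : {vspace 'rV[R]_d}) (L : 'rV[R]_d -> 'rV[R]_n)
    (D : 'rV[R]_d -> 'rV[R]_d) X0 :
  linear L -> linear D -> X0 \in q -> L X0 = X p0 ->
  (forall y, y \in q -> kropina_dom a X p0 (L y) ->
    (m + 1) * ip (L (D y)) (L y) * b (L y) = m * ip (L y) (L y) * b (L (D y))) ->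
  forall u v, u \in q -> v \in q -> ip (L (D u)) (L v) + ip (L u) (L (D v)) = 0.
Proof.
move=> LL DL X0q LX0 E u v uq vq.
(* The existential keeps [Q] opaque, so that its values are atoms for [ring] and [lra]. *)
have [Q QP] : exists Q, forall y w, Q y w = ip (L (D y)) (L w) by eexists.
have Ql k s t w : Q (k *: s + t) w = k * Q s w + Q t w.
  by rewrite !QP DL LL innerDl innerZl.
have Qr k s t w : Q w (k *: s + t) = k * Q w s + Q w t.
  by rewrite !QP LL innerDr innerZr.
have c0 : 0 < b (X p0) by exact: a_pos.
have bQ s : b (L (D s)) = Q s X0 by rewrite QP LX0; exact: inner_sym.
have key w : w \in q -> b (L w) = 0 ->
    [/\ Q X0 X0 = 0, Q w w = 0, Q w X0 = 0 & Q X0 w = 0].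
  move=> wq bw.
  have := @cubic_identity _ m (b (X p0)) (ip (L w) (L w)) (Q X0 X0)
    (Q X0 w + Q w X0) (Q w w) (Q w X0) hm0 _ (lt0r_neq0 c0).
  case=> [|t|Q0 Q2 al Q1]; first by rewrite -[1]opprK subr_eq0.
    have tE : L (t *: w + X0) = t *: L w + X p0 by rewrite LL LX0.
    have bt : b (t *: L w + X p0) = b (X p0) by rewrite innerDr innerZr bw mulr0 add0r.
    have tq : t *: w + X0 \in q by rewrite memvD ?memvZ.
    have := E _ tq; rewrite -QP tE bQ bt.
    have -> : ip (t *: L w + X p0) (t *: L w + X p0) = b (X p0) + t ^+ 2 * ip (L w) (L w).
      by rewrite !innerDr !innerZr !innerDl !innerZl (inner_sym (L w) (X p0) a_sym) bw; ring.
    have -> : Q (t *: w + X0) (t *: w + X0) = Q X0 X0 + t * (Q X0 w + Q w X0) + t ^+ 2 * Q w w.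
      by rewrite Ql !Qr; ring.
    rewrite Ql (addrC (t * Q w X0)); apply.
    by rewrite /kropina_dom /= bt.
  (* If [L w = 0], then [al] says nothing; instead [Q X0 w = 0] is immediate and [Q1] reduces to
     (m+1) [Q w X0] = m [Q w X0]. *)
  have [Lw0|Lw0] := eqVneq (L w) 0.
    have Q1w : Q X0 w = 0 by rewrite QP Lw0 linear0.
    have Qw1 : Q w X0 = 0 by move: Q1; rewrite Q1w; lra.
    by split.
  have Qw1 : Q w X0 = 0.
    by move/eqP: al; rewrite mulf_eq0 gt_eqF ?a_pos //= => /eqP.
  split=> //; move/eqP: Q1; rewrite Qw1 addr0 mulr0 mulf_eq0 => /orP[|/eqP //].
  by rewrite -[1]opprK subr_eq0 (negbTE hm1).
have diag y : y \in q -> Q y y = 0.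
  move=> yq; pose s := b (L y) / b (X p0); pose w := y - s *: X0.
  have wq : w \in q by rewrite memvB ?memvZ.
  have yE : y = s *: X0 + w by rewrite addrC subrK.
  have bw : b (L w) = 0.
    rewrite /w addrC -scaleNr LL LX0 innerDr innerZr mulNr divfK ?addNr //.
    exact: lt0r_neq0.
  have [k1 k2 k3 k4] := key w wq bw.
  by rewrite yE Ql !Qr k1 k2 k3 k4; ring.
(* Polarization of [diag], with the scalar 1 written out to match [Ql] and [Qr]. *)
have uvq : 1 *: u + v \in q by rewrite scale1r memvD.
rewrite (inner_sym (L u) _ a_sym) -!QP.
have := diag _ uvq; rewrite Ql !Qr (diag u uq) (diag v vq); lra.
Qed.

Lemma finsler_to_riemannian :
  finsler_naturally_reductive SG SM (kropina_dom a X) (kropina a X m) ->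
  riemannian_naturally_reductive SG SM a.
Proof.
case=> h [q [hq fnr]]; exists h, q; split => // z u v zq.
have [X0 X0q X0E] := tangent_proj_lift hSM hq (X p0).
apply: (skew_of_kropina_identity (tangent_proj_is_linear SG SM)
  (bracket_proj_is_linear hG h q z) X0q X0E) => y yq yD.
apply: (kropina_dlog_eq0 a_sym a_pos yD).
have y0 : y != 0.
  apply: contraTneq yD => ->; rewrite /kropina_dom /= /tangent_proj /mdiff.
  by rewrite !linear0 ltxx.
have := fnr y z y y yq y0 yD zq yq yq.
rewrite !fundamental_tensor_tangent_proj cartan_tensor_tangent_proj.
rewrite (kropina_dlog_euler _ yD) => /eqP; rewrite mulf_eq0 => /orP[|/eqP //].
by rewrite gt_eqF //; exact: (kropina_sqr_gt0 m a_pos yD).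
Qed.

Lemma riemannian_to_finsler :
  (forall u v, b (tp (lie_bracket SG u v)) = 0) ->
  riemannian_naturally_reductive SG SM a ->
  finsler_naturally_reductive SG SM (kropina_dom a X) (kropina a X m).
Proof.
move=> closed [h [q [hq rnr]]]; exists h, q; split => // y z u v yq y0 yD zq uq vq.
have nr s t : s \in q -> t \in q ->
    ip (tp (bracket_proj SG h q z s)) (tp t) + ip (tp s) (tp (bracket_proj SG h q z t)) = 0.
  by move=> sq tq; exact: rnr.
have bB s : b (tp (bracket_proj SG h q z s)) = 0.
  by rewrite (tangent_proj_bracket_proj hSM hq).
have yy0 : ip (tp (bracket_proj SG h q z y)) (tp y) = 0.
  by have := nr y y yq yq; rewrite (inner_sym (tp y) _ a_sym); lra.
have E := kropina_naturally_reductive m a_sym a_pos yD yy0 (nr u y uq yq) (nr v y vq yq)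
  (nr u v uq vq) (bB y) (bB u) (bB v).
apply: etrans E.
exact: (congr2 +%R (congr2 +%R (fundamental_tensor_tangent_proj y _ v)
  (fundamental_tensor_tangent_proj y _ u))
  (congr1 ( *%R 2) (cartan_tensor_tangent_proj y _ u v))).
Qed.

End Equivalence.

Theorem theorem4p1 (R : realType) (d n : nat)
    (G : topGroupType) (SG : smooth_structure R G d)
    (hG : lie_group SG) (hcompact : compact [set: G])
    (H : closed_subgroup G) (SM : smooth_structure R (coset_space H) n)
    (hSM : submersion SG SM (@coset_proj G H))
    (a : coset_space H -> 'M[R]_n)
    (ha : riemannian_metric SM a) (ha_inv : invariant_metric SM a)
    (X : coset_space H -> 'rV[R]_n)
    (hX : smooth_field SM X) (hX_inv : invariant_field SM X)
    (hX0 : X (base_point H) != 0)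
    (m : R) (hm0 : m != 0) (hm1 : m != -1)
    (hF : finsler_metric SM (kropina_dom a X) (kropina a X m))
    (hF_inv : invariant_finsler SM (kropina_dom a X) (kropina a X m))
    (hF_berwald : berwald_type SM (kropina_dom a X) (kropina a X m)) :
  finsler_naturally_reductive SG SM (kropina_dom a X) (kropina a X m) <->
  riemannian_naturally_reductive SG SM a.
Proof.
split; first exact: finsler_to_riemannian.
apply: riemannian_to_finsler => // u v.
apply: (invariant_form_bracket hG hSM ha ha_inv hX hX_inv hX0) => j k.
exact: (berwald_form_closed ha ha_inv hX hX_inv hX0 hm0 hm1 hF hF_berwald).
Qed.
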